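(* The pseudofunctor $\Omega^{\mathrm{ex}}\colon\mathbf{ClIdl}^{\mathrm{ex}}\to\mathbf{ClIdl}^{\mathrm{ex}}$, $(\mathcal{C},\mathcal{N})\mapsto(\mathrm{Ses}(\mathcal{C}),[\mathcal{N}])$, $G\mapsto[G]$, $\alpha\mapsto[\alpha]$, extends to a pseudo-comonad on the 2-category $\mathbf{ClIdl}^{\mathrm{ex}}$ of categories equipped with a closed ideal that have all (relative) kernels and cokernels, and functors that preserve exact sequences, with counit and comultiplication having the components $\epsilon_{\mathcal{C}}$, $\delta_{\mathcal{C}}$ described in the context. Moreover, all pretorsion theories on semiexact categories are pseudo-coalgebras for $\Omega^{\mathrm{ex}}$: for every pretorsion theory $(\mathcal{C},\mathcal{T},\mathcal{F})$ such that $\mathcal{C}$ has all kernels and cokernels relative to the ideal $\mathcal{N}$ of morphisms factoring through $\mathcal{T}\cap\mathcal{F}$, the functor $\lambda\colon\mathcal{C}\to\mathrm{Ses}(\mathcal{C})$, $X\mapsto(T^X\to X\to F^X)$, $h\mapsto(h^T,h,h^F)$, is the coalgebra map of a (normal) pseudo-coalgebra structure on $(\mathcal{C},\mathcal{N})$ for $\Omega^{\mathrm{ex}}$.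
   Context: **Ideals, kernels, short exact sequences.** An ideal $\mathcal{N}$ of null morphisms in a category $\mathcal{C}$ is a class of morphisms closed under pre- and post-composition with arbitrary morphisms. A null object is an object whose identity is null. $\mathcal{N}$ is closed if every null morphism factors through a null object. An $\mathcal{N}$-kernel of $f\colon A\to B$ is a morphism $k\colon K\to A$ with $fk\in\mathcal{N}$ such that every $h$ with codomain $A$ and $fh\in\mathcal{N}$ factors uniquely through $k$; $\mathcal{N}$-cokernels are dual. $K(f)$, $C(f)$ denote kernel and cokernel objects, $\ker(f)$, $\mathrm{coker}(f)$ the chosen kernel and cokernel morphisms. A sequence $X\xrightarrow{f}Y\xrightarrow{g}Z$ is short exact if $f$ is an $\mathcal{N}$-kernel of $g$ and $g$ is an $\mathcal{N}$-cokernel of $f$. A semiexact category is a category with a closed ideal $\mathcal{N}$ admitting all $\mathcal{N}$-kernels and $\mathcal{N}$-cokernels. A morphism $\xi$ reflects null morphisms if $\xi h$ null implies $h$ null; it coreflects null morphisms if $h\xi$ null implies $h$ null. **Exact sequences.** An exact sequence is a pair $X\xrightarrow{f}Y\xrightarrow{g}Z$ with $gf$ null such that, writing $f=\ker(g)\circ\xi^1$ and $g=\xi^2\circ\mathrm{coker}(f)$ for the induced $\xi^1\colon X\to K(g)$, $\xi^2\colon C(f)\to Z$, the sequence $K(g)\xrightarrow{\ker(g)}Y\xrightarrow{\mathrm{coker}(f)}C(f)$ is short exact (the short exact sequence replacement), $\xi^1$ coreflects null morphisms and $\xi^2$ reflects null morphisms. A choice of replacement is fixed for each exact sequence; a short exact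 sequence is its own replacement. **$\mathrm{Ses}(\mathcal{C})$.** Objects are short exact sequences in $\mathcal{C}$; morphisms from $X\xrightarrow{f}Y\xrightarrow{g}Z$ to $X'\xrightarrow{f'}Y'\xrightarrow{g'}Z'$ are triples $(u,v,w)$ with $vf=f'u$, $wg=g'v$. The closed ideal $[\mathcal{N}]$ on $\mathrm{Ses}(\mathcal{C})$ consists of the morphisms that factor through a short exact sequence both of whose morphisms are isomorphisms. An object of $\mathrm{Ses}(\mathrm{Ses}(\mathcal{C}))$ is viewed as a $3\times3$ diagram whose rows are objects of $\mathrm{Ses}(\mathcal{C})$. **$\mathbf{ClIdl}^{\mathrm{ex}}$.** Objects: pairs $(\mathcal{C},\mathcal{N})$ with $\mathcal{N}$ a closed ideal having all $\mathcal{N}$-kernels and $\mathcal{N}$-cokernels. Morphisms: functors sending exact sequences to exact sequences. 2-cells: natural transformations. **The pseudofunctor $\Omega^{\mathrm{ex}}$.** On objects $(\mathcal{C},\mathcal{N})\mapsto(\mathrm{Ses}(\mathcal{C}),[\mathcal{N}])$. For $G\colon\mathcal{C}\to\mathcal{D}$ in $\mathbf{ClIdl}^{\mathrm{ex}}$, $[G]$ sends $X\xrightarrow{f}Y\xrightarrow{g}Z$ to the chosen short exact sequence replacement $K(G(g))\to G(Y)\to C(G(f))$ of $G(X)\to G(Y)\to G(Z)$, and sends $(u,v,w)$ to the unique morphism of short exact sequences with middle component $G(v)$. For $\alpha\colon G\Rightarrow H$, the component of $[\alpha]$ at $X\to Y\to Z$ is the unique morphism of short exact sequences $[G](X\to Y\to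 Z)\to[H](X\to Y\to Z)$ with middle component $\alpha_Y$. $\Omega^{\mathrm{ex}}$ strictly preserves identities, and the comparison isomorphisms $[H]\circ[G]\cong[H\circ G]$ are the unique ones with identity middle component. **Counit and comultiplication.** $\epsilon_{\mathcal{C}}\colon\mathrm{Ses}(\mathcal{C})\to\mathcal{C}$ sends $X\to Y\to Z$ to $Y$ and $(u,v,w)$ to $v$. $\delta_{\mathcal{C}}\colon\mathrm{Ses}(\mathcal{C})\to\mathrm{Ses}(\mathrm{Ses}(\mathcal{C}))$ sends $X\xrightarrow{f}Y\xrightarrow{g}Z$ to the $3\times3$ diagram with rows $$X\xrightarrow{\mathrm{id}}X\xrightarrow{\mathrm{coker}(\mathrm{id}_X)}C(\mathrm{id}_X),\qquad X\xrightarrow{f}Y\xrightarrow{g}Z,\qquad K(\mathrm{id}_Z)\xrightarrow{\ker(\mathrm{id}_Z)}Z\xrightarrow{\mathrm{id}}Z,$$ with vertical morphisms $(\mathrm{id}_X,f,w_0)$ and $(u_0,g,\mathrm{id}_Z)$, where $w_0\,\mathrm{coker}(\mathrm{id}_X)=gf$ and $\ker(\mathrm{id}_Z)\,u_0=gf$; it acts on a morphism $(u,v,w)$ by $(u,v,w)$ on middle rows, $(u,u,\bar u)$ on top rows and $(\bar w,w,w)$ on bottom rows, with $\bar u,\bar w$ induced by universal properties. The counit is 2-natural and the comultiplication is pseudo-natural. **Pseudo-comonads and pseudo-coalgebras.** A pseudo-comonad on a 2-category consists of a pseudofunctor $\Omega$, pseudo-natural transformations $\epsilon\colon\Omega\Rightarrow\mathrm{Id}$,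 $\delta\colon\Omega\Rightarrow\Omega\Omega$ and invertible modifications $\Omega\delta\circ\delta\cong\delta\Omega\circ\delta$, $\epsilon\Omega\circ\delta\cong\mathrm{id}$, $\Omega\epsilon\circ\delta\cong\mathrm{id}$ satisfying the usual coherence axioms. ''Pseudo-coalgebra'' means normal pseudo-coalgebra: an object $\mathcal{C}$, a 1-cell $\lambda\colon\mathcal{C}\to\Omega\mathcal{C}$ with $\epsilon_{\mathcal{C}}\circ\lambda=\mathrm{id}$ strictly, and an invertible 2-cell $\lambda_\delta\colon\Omega(\lambda)\circ\lambda\cong\delta_{\mathcal{C}}\circ\lambda$ satisfying the usual coherence axioms. **Pretorsion theories.** A pretorsion theory $(\mathcal{C},\mathcal{T},\mathcal{F})$ is a category $\mathcal{C}$ with full replete subcategories $\mathcal{T}$, $\mathcal{F}$ such that, with $\mathcal{N}$ the ideal of morphisms factoring through an object of $\mathcal{T}\cap\mathcal{F}$: (T1) every morphism from an object of $\mathcal{T}$ to an object of $\mathcal{F}$ is in $\mathcal{N}$; (T2) every object $X$ admits an $\mathcal{N}$-short exact sequence $T^X\xrightarrow{\ell^X}X\xrightarrow{r^X}F^X$ with $T^X\in\mathcal{T}$, $F^X\in\mathcal{F}$. A choice of such a sequence is fixed for every object; for $h\colon X\to Y$, $h^T\colon T^X\to T^Y$ and $h^F\colon F^X\to F^Y$ are the unique morphisms with $\ell^Yh^T=h\ell^X$ and $h^Fr^X=r^Yh$. *)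

(* Defs.v *)
From Stdlib Require Import ssreflect Description ClassicalEpsilon.
From Stdlib Require Import ProofIrrelevance FunctionalExtensionality.

Set Implicit Arguments.
Unset Strict Implicit.
Unset Printing Implicit Defensive.

Record Cat := {
  Ob :> Type;
  Hom : Ob -> Ob -> Type;
  idm : forall A, Hom A A;
  cmp : forall A B C, Hom B C -> Hom A B -> Hom A C;
  cmpA : forall A B C D (h : Hom C D) (g : Hom B C) (f : Hom A B),
    cmp h (cmp g f) = cmp (cmp h g) f;
  cmp1m : forall A B (f : Hom A B), cmp (idm B) f = f;
  cmpm1 : forall A B (f : Hom A B), cmp f (idm A) = f }.
Arguments Hom {c} A B.
Arguments idm {c} A.
Arguments cmp {c A B C} g f.
Notation "g ∘ f" := (cmp g f) (at level 41, right associativity).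

Definition IsIso (C : Cat) (A B : C) (f : Hom A B) : Prop :=
  exists g : Hom B A, g ∘ f = idm A /\ f ∘ g = idm B.

Record Functor (C D : Cat) := {
  fob :> C -> D;
  fmap : forall A B : C, Hom A B -> Hom (fob A) (fob B);
  fmap1 : forall A : C, fmap (idm A) = idm (fob A);
  fmapM : forall (X Y Z : C) (g : Hom Y Z) (f : Hom X Y),
    fmap (g ∘ f) = fmap g ∘ fmap f }.
Arguments fmap {C D} F {A B} f : rename.

Definition functor_id (C : Cat) : Functor C C :=
  {| fob := fun X => X; fmap := fun A B f => f;
     fmap1 := fun A => eq_refl; fmapM := fun _ _ _ _ _ => eq_refl |}.

Definition functor_comp (C D E : Cat) (G : Functor D E) (F : Functor C D) :
  Functor C E.
Proof.
refine {| fob := fun X => G (F X); fmap := fun A B f => fmap G (fmap F f) |}.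
- by move=> A; rewrite !fmap1.
- by move=> X Y Z g f; rewrite !fmapM.
Defined.

Record NatTrans (C D : Cat) (F G : Functor C D) := {
  nt :> forall X : C, Hom (F X) (G X);
  nt_nat : forall (X Y : C) (f : Hom X Y), nt Y ∘ fmap F f = fmap G f ∘ nt X }.

Lemma nt_ext (C D : Cat) (F G : Functor C D) (a b : NatTrans F G) :
  (forall X, a X = b X) -> a = b.
Proof.
case: a b => [a an] [b bn] /= H.
have E : a = b by apply: functional_extensionality_dep.
by subst b; f_equal; apply: proof_irrelevance.
Qed.

Record Ideal (C : Cat) := {
  null : forall A B : C, Hom A B -> Prop;
  null_post : forall (X Y Z : C) (g : Hom Y Z) (f : Hom X Y),
    null f -> null (g ∘ f);
  null_pre : forall (X Y Z : C) (g : Hom Y Z) (f : Hom X Y),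
    null g -> null (g ∘ f) }.
Arguments null {C} N {A B} f : rename.

Section IdealTheory.
Variables (C : Cat) (N : Ideal C).

Definition NullOb (A : C) : Prop := null N (idm A).

Definition ClosedIdeal : Prop :=
  forall (X Y : C) (f : Hom X Y), null N f ->
  exists (A : C) (b : Hom A Y) (a : Hom X A), NullOb A /\ f = b ∘ a.

Definition IsKernel (A B K : C) (f : Hom A B) (k : Hom K A) : Prop :=
  null N (f ∘ k) /\
  forall (H : C) (h : Hom H A), null N (f ∘ h) ->
  exists! h' : Hom H K, h = k ∘ h'.

Definition IsCokernel (A B Q : C) (f : Hom A B) (q : Hom B Q) : Prop :=
  null N (q ∘ f) /\
  forall (H : C) (h : Hom B H), null N (h ∘ f) ->
  exists! h' : Hom Q H, h = h' ∘ q.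

Definition HasKernels : Prop :=
  forall (A B : C) (f : Hom A B), exists (K : C) (k : Hom K A), IsKernel f k.

Definition HasCokernels : Prop :=
  forall (A B : C) (f : Hom A B), exists (Q : C) (q : Hom B Q), IsCokernel f q.

Record Kernel (A B : C) (f : Hom A B) := {
  ker_ob : C;
  ker : Hom ker_ob A;
  ker_is : IsKernel f ker }.

Record Cokernel (A B : C) (f : Hom A B) := {
  coker_ob : C;
  coker : Hom B coker_ob;
  coker_is : IsCokernel f coker }.

Definition ShortExact (X Y Z : C) (f : Hom X Y) (g : Hom Y Z) : Prop :=
  IsKernel g f /\ IsCokernel f g.

Definition ReflectsNull (A B : C) (xi : Hom A B) : Prop :=
  forall (H : C) (h : Hom H A), null N (xi ∘ h) -> null N h.

Definition CoreflectsNull (A B : C) (xi : Hom A B) : Prop :=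
  forall (H : C) (h : Hom B H), null N (h ∘ xi) -> null N h.

Record SesOb := MkSes {
  sX : C; sY : C; sZ : C;
  sf : Hom sX sY;
  sg : Hom sY sZ;
  s_short : ShortExact sf sg }.

Record SesHom (S S' : SesOb) := MkSesHom {
  mu : Hom (sX S) (sX S');
  mv : Hom (sY S) (sY S');
  mw : Hom (sZ S) (sZ S');
  muE : mv ∘ sf S = sf S' ∘ mu;
  mwE : mw ∘ sg S = sg S' ∘ mv }.

(* The morphisms rep_ker and rep_coker are an arbitrary kernel of g and an
   arbitrary cokernel of f; exactness does not depend on the choice. *)
Record Replacement (X Y Z : C) (f : Hom X Y) (g : Hom Y Z) := {
  rep_K : C; rep_C : C;
  rep_ker : Hom rep_K Y;
  rep_coker : Hom Y rep_C;
  rep_xi1 : Hom X rep_K;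
  rep_xi2 : Hom rep_C Z;
  rep_ker_is : IsKernel g rep_ker;
  rep_coker_is : IsCokernel f rep_coker;
  rep_fE : f = rep_ker ∘ rep_xi1;
  rep_gE : g = rep_xi2 ∘ rep_coker;
  rep_short : ShortExact rep_ker rep_coker;
  rep_xi1_coreflects : CoreflectsNull rep_xi1;
  rep_xi2_reflects : ReflectsNull rep_xi2 }.

Definition rep_ses (X Y Z : C) (f : Hom X Y) (g : Hom Y Z)
  (R : Replacement f g) : SesOb := MkSes (rep_short R).

Definition Exact (X Y Z : C) (f : Hom X Y) (g : Hom Y Z) : Prop :=
  null N (g ∘ f) /\ inhabited (Replacement f g).

Definition kfac (A B K : C) (f : Hom A B) (k : Hom K A) (kP : IsKernel f k)
    (H : C) (h : Hom H A) (hn : null N (f ∘ h)) : Hom H K :=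
  proj1_sig (constructive_definite_description _ (proj2 kP H h hn)).

Definition cfac (A B Q : C) (f : Hom A B) (q : Hom B Q) (qP : IsCokernel f q)
    (H : C) (h : Hom B H) (hn : null N (h ∘ f)) : Hom Q H :=
  proj1_sig (constructive_definite_description _ (proj2 qP H h hn)).

Lemma kfacE (A B K : C) (f : Hom A B) (k : Hom K A) (kP : IsKernel f k)
  (H : C) (h : Hom H A) (hn : null N (f ∘ h)) : h = k ∘ kfac kP hn.
Proof. by rewrite /kfac; case: constructive_definite_description. Qed.

Lemma cfacE (A B Q : C) (f : Hom A B) (q : Hom B Q) (qP : IsCokernel f q)
  (H : C) (h : Hom B H) (hn : null N (h ∘ f)) : h = cfac qP hn ∘ q.
Proof. by rewrite /cfac; case: constructive_definite_description. Qed.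

Lemma ker_mono (A B K : C) (f : Hom A B) (k : Hom K A) (kP : IsKernel f k)
  (H : C) (a b : Hom H K) : k ∘ a = k ∘ b -> a = b.
Proof.
move=> E; have hn : null N (f ∘ (k ∘ a)).
  by rewrite cmpA; apply: null_pre; case: kP.
case: (proj2 kP _ _ hn) => c [_ U].
by rewrite -(U a) // -(U b).
Qed.

Lemma coker_epi (A B Q : C) (f : Hom A B) (q : Hom B Q) (qP : IsCokernel f q)
  (H : C) (a b : Hom Q H) : a ∘ q = b ∘ q -> a = b.
Proof.
move=> E; have hn : null N ((a ∘ q) ∘ f).
  by rewrite -cmpA; apply: null_post; case: qP.
case: (proj2 qP _ _ hn) => c [_ U].
by rewrite -(U a) // -(U b).
Qed.

Lemma IsKernelP (A B K : C) (f : Hom A B) (k : Hom K A) :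
  null N (f ∘ k) ->
  (forall H (a b : Hom H K), k ∘ a = k ∘ b -> a = b) ->
  (forall H (h : Hom H A), null N (f ∘ h) -> exists h', h = k ∘ h') ->
  IsKernel f k.
Proof.
move=> n m e; split=> // H h hn; case: (e _ _ hn) => h' ->.
by exists h'; split=> // h''; apply: m.
Qed.

Lemma IsCokernelP (A B Q : C) (f : Hom A B) (q : Hom B Q) :
  null N (q ∘ f) ->
  (forall H (a b : Hom Q H), a ∘ q = b ∘ q -> a = b) ->
  (forall H (h : Hom B H), null N (h ∘ f) -> exists h', h = h' ∘ q) ->
  IsCokernel f q.
Proof.
move=> n m e; split=> // H h hn; case: (e _ _ hn) => h' ->.
by exists h'; split=> // h''; apply: m.
Qed.

Lemma ses_null (S : SesOb) : null N (sg S ∘ sf S).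
Proof. by case: (s_short S) => [[]]. Qed.

Definition self_replacement (X Y Z : C) (f : Hom X Y) (g : Hom Y Z)
  (s : ShortExact f g) : Replacement f g.
Proof.
refine (@Build_Replacement _ _ _ f g X Z f g (idm X) (idm Z)
  (proj1 s) (proj2 s) _ _ s _ _).
- by rewrite cmpm1.
- by rewrite cmp1m.
- by move=> H h; rewrite cmpm1.
- by move=> H h; rewrite cmp1m.
Defined.

Lemma short_exact (X Y Z : C) (f : Hom X Y) (g : Hom Y Z) :
  ShortExact f g -> Exact f g.
Proof.
move=> s; split; first by case: s => [[]].
by constructor; apply: self_replacement.
Qed.

Lemma ses_hom_ext (S S' : SesOb) (m n : SesHom S S') : mv m = mv n -> m = n.
Proof.
case: m n => [u v w uE wE] [u' v' w' uE' wE'] /= E; subst v'.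
have Eu : u = u'.
  by apply: (ker_mono (proj1 (s_short S'))); rewrite -uE -uE'.
have Ew : w = w'.
  by apply: (coker_epi (proj2 (s_short S))); rewrite wE wE'.
by subst; f_equal; apply: proof_irrelevance.
Qed.

Lemma ses_lift_l (S S' : SesOb) (v : Hom (sY S) (sY S')) :
  null N (sg S' ∘ v ∘ sf S) -> null N ((sg S' ∘ v) ∘ sf S).
Proof. by rewrite -cmpA. Qed.

(* The unique morphism of short exact sequences with middle component v. *)
Definition ses_lift (S S' : SesOb) (v : Hom (sY S) (sY S'))
    (vn : null N (sg S' ∘ v ∘ sf S)) : SesHom S S' :=
  {| mu := kfac (proj1 (s_short S')) vn;
     mv := v;
     mw := cfac (proj2 (s_short S)) (ses_lift_l vn);
     muE := kfacE (proj1 (s_short S')) vn;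
     mwE := eq_sym (cfacE (proj2 (s_short S)) (ses_lift_l vn)) |}.

Definition ses_id (S : SesOb) : SesHom S S.
Proof.
by apply: (@MkSesHom S S (idm _) (idm _) (idm _)); rewrite cmp1m cmpm1.
Defined.

Definition ses_cmp (S T U : SesOb) (n : SesHom T U) (m : SesHom S T) :
  SesHom S U.
Proof.
apply: (@MkSesHom S U (mu n ∘ mu m) (mv n ∘ mv m) (mw n ∘ mw m)).
- by rewrite -cmpA muE cmpA muE cmpA.
- by rewrite -cmpA mwE cmpA mwE cmpA.
Defined.

Definition Ses : Cat.
Proof.
refine (@Build_Cat SesOb SesHom ses_id ses_cmp _ _ _) => *;
  by apply: ses_hom_ext; rewrite /= ?cmpA ?cmp1m ?cmpm1.
Defined.

Definition SesIdeal : Ideal Ses.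
Proof.
refine (@Build_Ideal Ses (fun S S' m =>
  exists (E : Ses) (b : Hom E S') (a : Hom S E),
    IsIso (sf E) /\ IsIso (sg E) /\ m = b ∘ a) _ _).
- move=> X Y Z g f [E [b [a [i [j ->]]]]]; exists E, (g ∘ b), a.
  by rewrite cmpA.
- move=> X Y Z g f [E [b [a [i [j ->]]]]]; exists E, b, (a ∘ f).
  by rewrite cmpA.
Defined.

Lemma ses_mvE (S T U : Ses) (n : Hom T U) (m : Hom S T) :
  mv (n ∘ m) = mv n ∘ mv m.
Proof. by []. Qed.

Lemma NullOb_from (A X : C) (f : Hom A X) : NullOb A -> null N f.
Proof. by move=> h; rewrite -(cmpm1 f); apply: null_post. Qed.

Lemma NullOb_to (A X : C) (f : Hom X A) : NullOb A -> null N f.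
Proof. by move=> h; rewrite -(cmp1m f); apply: null_pre. Qed.

Variable closedN : ClosedIdeal.

Lemma iso_ses_null (E : SesOb) : IsIso (sf E) -> IsIso (sg E) -> NullOb (sY E).
Proof.
move=> [i [_ i1]] [j [j1 _]]; rewrite /NullOb -i1.
rewrite -(cmp1m (sf E)) -j1 -!cmpA.
by apply: null_post; rewrite cmpA; apply: null_pre; apply: ses_null.
Qed.

Lemma null_id_short (A : C) : NullOb A -> ShortExact (idm A) (idm A).
Proof.
move=> nA; split.
- apply: IsKernelP; first exact: NullOb_from.
  + by move=> H a b; rewrite !cmp1m.
  + by move=> H h _; exists h; rewrite cmp1m.
- apply: IsCokernelP; first exact: NullOb_from.
  + by move=> H a b; rewrite !cmpm1.
  + by move=> H h _; exists h; rewrite cmpm1.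
Qed.

Lemma ses_nullP (S S' : Ses) (m : Hom S S') :
  null SesIdeal m <-> null N (mv m).
Proof.
split.
- move=> [E [b [a [i [j ->]]]]] /=.
  by apply: null_pre; apply: NullOb_from; apply: iso_ses_null.
- case/closedN => [A [b [a [nA E]]]].
  pose I : Ses := MkSes (null_id_short nA).
  have an : null N (sg I ∘ a ∘ sf S).
    by rewrite /= ; apply: null_pre.
  have bn : null N (sg S' ∘ b ∘ sf I).
    by rewrite /= ; do 2 apply: null_post.
  exists I, (ses_lift bn), (ses_lift an).
  split; [|split].
  + by exists (idm A); rewrite /= cmp1m.
  + by exists (idm A); rewrite /= cmp1m.
  + exact: ses_hom_ext.
Qed.

Lemma ses_null_ob (E : SesOb) :
  IsIso (sf E) -> IsIso (sg E) -> null SesIdeal (idm (E : Ses)).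
Proof. by move=> i j; apply/ses_nullP; apply: iso_ses_null. Qed.

Lemma ses_ker_build (A B K : C) (a : Hom A B) (k : Hom K A) :
  HasKernels -> HasCokernels ->
  exists (X Z : C) (j : Hom X K) (q : Hom K Z),
    ShortExact j q /\ IsKernel (a ∘ k) j.
Proof.
move=> hk hc; case: (hk _ _ (a ∘ k)) => X [j jP].
case: (hc _ _ j) => Z [q qP]; exists X, Z, j, q; split=> //; split=> //.
apply: IsKernelP; first by case: qP.
- by move=> H x y; apply: (ker_mono jP).
- move=> H h hn; case: (proj2 qP _ (a ∘ k) (proj1 jP)) => t [tE _].
  have hn' : null N ((a ∘ k) ∘ h) by rewrite tE -cmpA; apply: null_post.
  by exists (kfac jP hn'); apply: kfacE.
Qed.

Lemma ses_coker_build (A B Q : C) (a : Hom A B) (c : Hom B Q) :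
  HasKernels -> HasCokernels ->
  exists (X Z : C) (j : Hom X Q) (q : Hom Q Z),
    ShortExact j q /\ IsCokernel (c ∘ a) q.
Proof.
move=> hk hc; case: (hc _ _ (c ∘ a)) => Z [q qP].
case: (hk _ _ q) => X [j jP]; exists X, Z, j, q; split=> //; split=> //.
apply: IsCokernelP; first by case: jP.
- by move=> H x y; apply: (coker_epi qP).
- move=> H h hn; case: (proj2 jP _ (c ∘ a) (proj1 qP)) => t [tE _].
  have hn' : null N (h ∘ (c ∘ a)) by rewrite tE cmpA; apply: null_pre.
  by exists (cfac qP hn'); apply: cfacE.
Qed.

Lemma ses_null_factor (S : SesOb) (H : C) (h : Hom H (sY S)) (t : Hom H (sX S)) :
  h = sf S ∘ t -> null N (sg S ∘ h).
Proof. by move=> ->; rewrite cmpA; apply: null_pre; apply: ses_null. Qed.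

Lemma ses_null_cofactor (S : SesOb) (H : C) (h : Hom (sY S) H)
  (t : Hom (sZ S) H) : h = t ∘ sg S -> null N (h ∘ sf S).
Proof. by move=> ->; rewrite -cmpA; apply: null_post; apply: ses_null. Qed.


End IdealTheory.

Section SesTheory.
Variables (C : Cat) (N : Ideal C) (closedN : ClosedIdeal N).
Variables (hk : HasKernels N) (hc : HasCokernels N).

Notation SC := (Ses N).
Notation SN := (SesIdeal N).

Let nullP := ses_nullP closedN.

Lemma ses_isker (S S' K : SC) (m : Hom S S') (k : Hom K S) :
  IsKernel N (mv m) (mv k) -> IsKernel N (sg S ∘ mv k) (sf K) ->
  IsKernel SN m k.
Proof.
move=> kP jP; apply: IsKernelP.
- by apply/nullP; case: kP.
- move=> H a b E; apply: ses_hom_ext; apply: (ker_mono kP).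
  by rewrite -!ses_mvE E.
- move=> H h /nullP hn; case: (proj2 kP _ (mv h) hn) => v [vE _].
  have ln : null N (sg K ∘ v ∘ sf H).
    have n0 : null N ((sg S ∘ mv k) ∘ v ∘ sf H).
      rewrite -!cmpA (cmpA (mv k)) -vE muE cmpA.
      by apply: null_pre; apply: ses_null.
    exact: (ses_null_factor (kfacE jP n0)).
  exists (ses_lift ln); exact: ses_hom_ext.
Qed.

Lemma ses_iscoker (S S' Q : SC) (m : Hom S S') (c : Hom S' Q) :
  IsCokernel N (mv m) (mv c) -> IsCokernel N (mv c ∘ sf S') (sg Q) ->
  IsCokernel SN m c.
Proof.
move=> cP jP; apply: IsCokernelP.
- by apply/nullP; case: cP.
- move=> H a b E; apply: ses_hom_ext; apply: (coker_epi cP).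
  by rewrite -!ses_mvE E.
- move=> H h /nullP hn; case: (proj2 cP _ (mv h) hn) => v [vE _].
  have ln : null N (sg H ∘ v ∘ sf Q).
    have n0 : null N ((sg H ∘ v) ∘ (mv c ∘ sf S')).
      rewrite -!cmpA (cmpA v) -vE cmpA -mwE -cmpA.
      by apply: null_post; apply: ses_null.
    rewrite cmpA; exact: (ses_null_cofactor (cfacE jP n0)).
  exists (ses_lift ln); exact: ses_hom_ext.
Qed.

Lemma ses_ker_over (S : SC) (K : C) (k : Hom K (sY S)) :
  exists (X Z : C) (j : Hom X K) (q : Hom K Z) (s : ShortExact N j q)
    (km : Hom (MkSes s : SC) S),
    mv km = k /\ IsKernel N (sg S ∘ k) j.
Proof.
case: (ses_ker_build (sg S) k hk hc) => X [Z [j [q [s jP]]]].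
exists X, Z, j, q, s.
have ln : null N (sg S ∘ k ∘ sf (MkSes s)) by rewrite cmpA; case: jP.
by exists (ses_lift (S := MkSes s) ln).
Qed.

Lemma ses_coker_over (S : SC) (Q : C) (c : Hom (sY S) Q) :
  exists (X Z : C) (j : Hom X Q) (q : Hom Q Z) (s : ShortExact N j q)
    (cm : Hom S (MkSes s : SC)),
    mv cm = c /\ IsCokernel N (c ∘ sf S) q.
Proof.
case: (ses_coker_build (sf S) c hk hc) => X [Z [j [q [s jP]]]].
exists X, Z, j, q, s.
have ln : null N (sg (MkSes s) ∘ c ∘ sf S) by case: jP.
by exists (ses_lift (S' := MkSes s) ln).
Qed.

Lemma ses_has_kernels : HasKernels SN.
Proof.
move=> S S' m; case: (hk (mv m)) => K [k kP].
case: (ses_ker_over k) => X [Z [j [q [s [km [E jP]]]]]]; subst k.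
by exists (MkSes s), km; apply: ses_isker.
Qed.

Lemma ses_has_cokernels : HasCokernels SN.
Proof.
move=> S S' m; case: (hc (mv m)) => Q [c cP].
case: (ses_coker_over c) => X [Z [j [q [s [cm [E jP]]]]]]; subst c.
by exists (MkSes s), cm; apply: ses_iscoker.
Qed.

Lemma ses_closed : ClosedIdeal SN.
Proof.
move=> S S' m [E [b [a [i [j ->]]]]]; exists E, b, a; split=> //.
exact: (ses_null_ob closedN).
Qed.

Lemma ses_isker_mid (S S' K : SC) (m : Hom S S') (k : Hom K S) :
  IsKernel SN m k ->
  IsKernel N (mv m) (mv k) /\ IsKernel N (sg S ∘ mv k) (sf K).
Proof.
move=> kP; case: (hk (mv m)) => L [l lP].
case: (ses_ker_over l) => X [Z [j [q [s [lm [E jP]]]]]]; subst l.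
have lmP : IsKernel SN m lm by apply: ses_isker.
case: (proj2 lmP _ k (proj1 kP)) => i [iE _].
case: (proj2 kP _ lm (proj1 lmP)) => i' [iE' _].
have ii' : i ∘ i' = idm _.
  by apply: (ker_mono lmP); rewrite cmpA -iE -iE' cmpm1.
have vE : mv lm ∘ mv i = mv k by rewrite iE.
have vE' : mv k ∘ mv i' = mv lm by rewrite iE'.
have i'i : i' ∘ i = idm _.
  by apply: (ker_mono kP); rewrite cmpA -iE' -iE cmpm1.
have vv' : mv i' ∘ mv i = idm _ by rewrite -ses_mvE i'i.
have ww' : mw i' ∘ mw i = idm _.
  by rewrite -[_ ∘ _]/(mw (i' ∘ i)) i'i.
split.
- apply: IsKernelP.
  + by case: kP => /nullP.
  + move=> H a b Eab.
    rewrite -(cmp1m a) -(cmp1m b) -vv' -!cmpA; congr (_ ∘ _).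
    by apply: (ker_mono lP); rewrite !cmpA vE.
  + move=> H h hn; exists (mv i' ∘ kfac lP hn).
    by rewrite cmpA vE' -kfacE.
- apply: IsKernelP.
  + rewrite -cmpA muE cmpA; apply: null_pre; exact: ses_null.
  + by move=> H a b; apply: (ker_mono (proj1 (s_short K))).
  + move=> H h hn.
    have n1 : null N ((sg S ∘ mv lm) ∘ (mv i ∘ h)).
      by rewrite -!cmpA (cmpA (mv lm)) vE cmpA.
    have n2 : null N (sg K ∘ h).
      rewrite -(cmp1m (sg K)) -ww' -!cmpA (cmpA (mw i)) mwE; apply: null_post.
      by rewrite -cmpA (kfacE jP n1) /= cmpA; apply: null_pre; apply: ses_null (MkSes s).
    exists (kfac (proj1 (s_short K)) n2); exact: kfacE.
Qed.

Lemma ses_iscoker_mid (S S' Q : SC) (m : Hom S S') (c : Hom S' Q) :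
  IsCokernel SN m c ->
  IsCokernel N (mv m) (mv c) /\ IsCokernel N (mv c ∘ sf S') (sg Q).
Proof.
move=> cP; case: (hc (mv m)) => L [l lP].
case: (ses_coker_over l) => X [Z [j [q [s [lm [E jP]]]]]]; subst l.
have lmP : IsCokernel SN m lm by apply: ses_iscoker.
case: (proj2 lmP _ c (proj1 cP)) => i [iE _].
case: (proj2 cP _ lm (proj1 lmP)) => i' [iE' _].
have vE : mv i ∘ mv lm = mv c by rewrite iE.
have vE' : mv i' ∘ mv c = mv lm by rewrite iE'.
have i'i : i ∘ i' = idm _.
  by apply: (coker_epi cP); rewrite -cmpA -iE' -iE cmp1m.
have vv' : mv i ∘ mv i' = idm _ by rewrite -ses_mvE i'i.
have uu' : mu i ∘ mu i' = idm _.
  by rewrite -[_ ∘ _]/(mu (i ∘ i')) i'i.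
split.
- apply: IsCokernelP.
  + by case: cP => /nullP.
  + move=> H a b Eab.
    rewrite -(cmpm1 a) -(cmpm1 b) -vv' !cmpA; congr (_ ∘ _).
    by apply: (coker_epi lP); rewrite -!cmpA vE.
  + move=> H h hn; exists (cfac lP hn ∘ mv i').
    by rewrite -cmpA vE' -cfacE.
- apply: IsCokernelP.
  + rewrite cmpA -mwE -cmpA; apply: null_post; exact: ses_null.
  + by move=> H a b; apply: (coker_epi (proj2 (s_short Q))).
  + move=> H h hn.
    have n1 : null N ((h ∘ mv i) ∘ (mv lm ∘ sf S')).
      by rewrite -!cmpA (cmpA (mv i)) vE.
    have n2 : null N (h ∘ sf Q).
      rewrite -(cmpm1 (sf Q)) -uu' (cmpA (sf Q)) -muE !cmpA; apply: null_pre.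
      by rewrite (cfacE jP n1) -cmpA; apply: null_post; apply: ses_null (MkSes s).
    exists (cfac (proj2 (s_short Q)) n2); exact: cfacE.
Qed.

Lemma id_coker_short (A Q : C) (q : Hom A Q) :
  IsCokernel N (idm A) q -> ShortExact N (idm A) q.
Proof.
move=> qP; split=> //; apply: IsKernelP; first by case: qP.
- by move=> H a b; rewrite !cmp1m.
- by move=> H h _; exists h; rewrite cmp1m.
Qed.

Lemma id_ker_short (A K : C) (k : Hom K A) :
  IsKernel N (idm A) k -> ShortExact N k (idm A).
Proof.
move=> kP; split=> //; apply: IsCokernelP; first by case: kP.
- by move=> H a b; rewrite !cmpm1.
- by move=> H h _; exists h; rewrite cmpm1.
Qed.

Lemma ses_coreflects (S S' : SC) (xi : Hom S S') :
  CoreflectsNull SN xi <-> CoreflectsNull N (mv xi).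
Proof.
split=> [cr H h hn | cr H h /nullP hn]; last by apply/nullP; apply: cr.
case: (hc (idm H)) => Q [q qP].
pose I : SC := MkSes (id_coker_short qP).
have qn : null N q by rewrite -(cmpm1 q); apply: (proj1 qP).
have ln : null N (sg I ∘ h ∘ sf S') by apply: null_pre.
by apply/(nullP (ses_lift ln : Hom S' I))/cr/nullP.
Qed.

Lemma ses_reflects (S S' : SC) (xi : Hom S S') :
  ReflectsNull SN xi <-> ReflectsNull N (mv xi).
Proof.
split=> [cr H h hn | cr H h /nullP hn]; last by apply/nullP; apply: cr.
case: (hk (idm H)) => K [k kP].
pose I : SC := MkSes (id_ker_short kP).
have kn : null N k by rewrite -(cmp1m k); apply: (proj1 kP).
have ln : null N (sg S ∘ h ∘ sf I) by do 2 apply: null_post.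
by apply/(nullP (ses_lift ln : Hom I S))/cr/nullP.
Qed.

Lemma ses_exactP (S T U : SC) (m : Hom S T) (n : Hom T U) :
  Exact SN m n <-> Exact N (mv m) (mv n).
Proof.
split=> [[mn [R]] | [mn [R]]]; split.
- by move/nullP: mn.
- case: R => K Q k c x1 x2 /ses_isker_mid [kP jP] /ses_iscoker_mid [cP qP] mE nE.
  move=> [/ses_isker_mid [kP' _] /ses_iscoker_mid [cP' _]].
  move=> /ses_coreflects r1 /ses_reflects r2.
  constructor; refine (Build_Replacement (rep_xi1 := mv x1) (rep_xi2 := mv x2)
    kP cP _ _ (conj kP' cP') r1 r2).
  + by rewrite mE.
  + by rewrite nE.
- exact/nullP.
- case: R => K Q k c x1 x2 kP cP mE nE [kP' cP'] r1 r2.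
  case: (ses_ker_over k) => X [Z [j [q [s [km [E jP]]]]]]; subst k.
  case: (ses_coker_over c) => X' [Z' [j' [q' [s' [cm [E jP']]]]]]; subst c.
  have n1 : null N (sg (MkSes s) ∘ x1 ∘ sf S).
    have h0 : null N ((sg T ∘ mv km) ∘ x1 ∘ sf S).
      rewrite -!cmpA (cmpA (mv km)) -mE muE cmpA.
      by apply: null_pre; apply: ses_null.
    exact: (ses_null_factor (S := MkSes s) (kfacE jP h0)).
  have n2 : null N (sg U ∘ x2 ∘ sf (MkSes s')).
    have h0 : null N ((sg U ∘ x2) ∘ (mv cm ∘ sf T)).
      rewrite -!cmpA (cmpA x2) -nE cmpA -mwE -cmpA.
      by apply: null_post; apply: ses_null.
    rewrite cmpA; exact: (ses_null_cofactor (S := MkSes s') (cfacE jP' h0)).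
  constructor; refine (@Build_Replacement SC SN S T U m n (MkSes s) (MkSes s') km cm
    (ses_lift n1) (ses_lift n2) _ _ _ _ _ _ _).
  + exact: ses_isker.
  + exact: ses_iscoker.
  + exact: ses_hom_ext.
  + exact: ses_hom_ext.
  + by split; [apply: ses_isker | apply: ses_iscoker].
  + exact/ses_coreflects.
  + exact/ses_reflects.
Qed.

End SesTheory.

Record TwoCatData := {
  ob0 :> Type;
  hom1 : ob0 -> ob0 -> Type;
  hom2 : forall A B : ob0, hom1 A B -> hom1 A B -> Type;
  id1 : forall A : ob0, hom1 A A;
  comp1 : forall A B C : ob0, hom1 B C -> hom1 A B -> hom1 A C;
  id2 : forall (A B : ob0) (f : hom1 A B), hom2 f f;
  comp2 : forall (A B : ob0) (f g h : hom1 A B),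
    hom2 g h -> hom2 f g -> hom2 f h;
  whiskl : forall (A B C : ob0) (h : hom1 B C) (f g : hom1 A B),
    hom2 f g -> hom2 (comp1 h f) (comp1 h g);
  whiskr : forall (A B C : ob0) (f g : hom1 B C),
    hom2 f g -> forall h : hom1 A B, hom2 (comp1 f h) (comp1 g h) }.
Arguments hom1 {t} A B.
Arguments hom2 {t A B} f g.
Arguments id1 {t} A.
Arguments comp1 {t A B C} g f.
Arguments id2 {t A B} f.
Arguments comp2 {t A B f g h} b a.
Arguments whiskl {t A B C} h {f g} a.
Arguments whiskr {t A B C f g} a h.
Notation "g ⊚ f" := (comp1 g f) (at level 41, right associativity).
Notation "b • a" := (comp2 b a) (at level 45, right associativity).
Notation "h ◁ a" := (whiskl h a) (at level 43, right associativity).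
Notation "a ▷ h" := (whiskr a h) (at level 42, left associativity).

Definition eq2 (K : TwoCatData) (A B : K) (f g : hom1 A B) (e : f = g) :
  hom2 f g := match e with eq_refl => id2 f end.

Record TwoCat := {
  tc_data :> TwoCatData;
  comp1A : forall (A B C D : tc_data) (h : hom1 C D) (g : hom1 B C)
    (f : hom1 A B), h ⊚ (g ⊚ f) = (h ⊚ g) ⊚ f;
  comp1_idl : forall (A B : tc_data) (f : hom1 A B), id1 B ⊚ f = f;
  comp1_idr : forall (A B : tc_data) (f : hom1 A B), f ⊚ id1 A = f;
  comp2A : forall (A B : tc_data) (f g h k : hom1 A B)
    (c : hom2 h k) (b : hom2 g h) (a : hom2 f g), c • (b • a) = (c • b) • a;
  comp2_idl : forall (A B : tc_data) (f g : hom1 A B) (a : hom2 f g),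
    id2 g • a = a;
  comp2_idr : forall (A B : tc_data) (f g : hom1 A B) (a : hom2 f g),
    a • id2 f = a;
  whiskl_id : forall (A B C : tc_data) (h : hom1 B C) (f : hom1 A B),
    h ◁ id2 f = id2 (h ⊚ f);
  whiskl_comp : forall (A B C : tc_data) (k : hom1 B C) (f g h : hom1 A B)
    (b : hom2 g h) (a : hom2 f g), k ◁ (b • a) = (k ◁ b) • (k ◁ a);
  whiskr_id : forall (A B C : tc_data) (h : hom1 B C) (f : hom1 A B),
    id2 h ▷ f = id2 (h ⊚ f);
  whiskr_comp : forall (A B C : tc_data) (k : hom1 A B) (f g h : hom1 B C)
    (b : hom2 g h) (a : hom2 f g), (b • a) ▷ k = (b ▷ k) • (a ▷ k);
  interchange : forall (A B C : tc_data) (f f' : hom1 A B) (g g' : hom1 B C)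
    (b : hom2 g g') (a : hom2 f f'),
    (b ▷ f') • (g ◁ a) = (g' ◁ a) • (b ▷ f);
  whiskl_idl : forall (A B : tc_data) (f g : hom1 A B) (a : hom2 f g),
    eq2 (comp1_idl g) • (id1 B ◁ a) = a • eq2 (comp1_idl f);
  whiskr_idr : forall (A B : tc_data) (f g : hom1 A B) (a : hom2 f g),
    eq2 (comp1_idr g) • (a ▷ id1 A) = a • eq2 (comp1_idr f);
  whiskllA : forall (A B C D : tc_data) (h : hom1 C D) (g : hom1 B C)
    (f f' : hom1 A B) (a : hom2 f f'),
    eq2 (comp1A h g f') • (h ◁ (g ◁ a)) = ((h ⊚ g) ◁ a) • eq2 (comp1A h g f);
  whisklrA : forall (A B C D : tc_data) (h : hom1 C D) (g g' : hom1 B C)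
    (f : hom1 A B) (a : hom2 g g'),
    eq2 (comp1A h g' f) • (h ◁ (a ▷ f)) = ((h ◁ a) ▷ f) • eq2 (comp1A h g f);
  whiskrrA : forall (A B C D : tc_data) (h h' : hom1 C D) (g : hom1 B C)
    (f : hom1 A B) (a : hom2 h h'),
    eq2 (comp1A h' g f) • (a ▷ (g ⊚ f)) = ((a ▷ g) ▷ f) • eq2 (comp1A h g f) }.

Section TwoCells.
Variable K : TwoCat.

Definition IsIso2 (A B : K) (f g : hom1 A B) (a : hom2 f g) : Prop :=
  exists b : hom2 g f, b • a = id2 f /\ a • b = id2 g.

(* Rebracketing and unit 2-cells (identities of the strict 2-category). *)
Definition asc (A B C D : K) (h : hom1 C D) (g : hom1 B C) (f : hom1 A B) :
  hom2 (h ⊚ (g ⊚ f)) ((h ⊚ g) ⊚ f) := eq2 (comp1A h g f).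
Definition csa (A B C D : K) (h : hom1 C D) (g : hom1 B C) (f : hom1 A B) :
  hom2 ((h ⊚ g) ⊚ f) (h ⊚ (g ⊚ f)) := eq2 (eq_sym (comp1A h g f)).
Definition lun (A B : K) (f : hom1 A B) : hom2 (id1 B ⊚ f) f :=
  eq2 (comp1_idl f).
Definition run (A B : K) (f : hom1 A B) : hom2 (f ⊚ id1 A) f :=
  eq2 (comp1_idr f).
Definition lunr (A B : K) (f : hom1 A B) : hom2 (id1 B ⊚ f) (f ⊚ id1 A) :=
  eq2 (eq_trans (comp1_idl f) (eq_sym (comp1_idr f))).
Definition runl (A B : K) (f : hom1 A B) : hom2 (f ⊚ id1 A) (id1 B ⊚ f) :=
  eq2 (eq_trans (comp1_idr f) (eq_sym (comp1_idl f))).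
End TwoCells.

(* The data of a pseudofunctor are separated from its axioms; the data of a
    pseudonatural transformation, and the modification axiom, depend only on
    the action of the pseudofunctors on 0-cells and 1-cells ([PfBase]). With
    primitive projections, composition of [PfBase] is associative and unital
    up to conversion. *)

Set Primitive Projections.
Record PfBase (K L : TwoCat) := {
  pf0 :> K -> L;
  pf1 : forall A B : K, hom1 A B -> hom1 (pf0 A) (pf0 B) }.
Unset Primitive Projections.
Arguments pf1 {K L} F {A B} f : rename.

Record PfData (K L : TwoCat) := {
  pf_base :> PfBase K L;
  pf2 : forall (A B : K) (f g : hom1 A B),
    hom2 f g -> hom2 (pf1 pf_base f) (pf1 pf_base g);
  pf_unit : forall A : K, hom2 (id1 (pf_base A)) (pf1 pf_base (id1 A));
  pf_mul : forall (A B C : K) (g : hom1 B C) (f : hom1 A B),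
    hom2 (pf1 pf_base g ⊚ pf1 pf_base f) (pf1 pf_base (g ⊚ f));
  pf_mulV : forall (A B C : K) (g : hom1 B C) (f : hom1 A B),
    hom2 (pf1 pf_base (g ⊚ f)) (pf1 pf_base g ⊚ pf1 pf_base f) }.
Arguments pf2 {K L} F {A B f g} a : rename.
Arguments pf_unit {K L} F A : rename.
Arguments pf_mul {K L} F {A B C} g f : rename.
Arguments pf_mulV {K L} F {A B C} g f : rename.

Record IsPseudofunctor (K L : TwoCat) (F : PfData K L) : Prop := {
  pf2_id : forall (A B : K) (f : hom1 A B), pf2 F (id2 f) = id2 (pf1 F f);
  pf2_comp : forall (A B : K) (f g h : hom1 A B) (b : hom2 g h) (a : hom2 f g),
    pf2 F (b • a) = pf2 F b • pf2 F a;
  pf_unit_iso : forall A : K, IsIso2 (pf_unit F A);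
  pf_mulK : forall (A B C : K) (g : hom1 B C) (f : hom1 A B),
    pf_mulV F g f • pf_mul F g f = id2 (pf1 F g ⊚ pf1 F f);
  pf_mulVK : forall (A B C : K) (g : hom1 B C) (f : hom1 A B),
    pf_mul F g f • pf_mulV F g f = id2 (pf1 F (g ⊚ f));
  pf_mul_natl : forall (A B C : K) (g : hom1 B C) (f f' : hom1 A B)
    (a : hom2 f f'),
    pf2 F (g ◁ a) • pf_mul F g f = pf_mul F g f' • (pf1 F g ◁ pf2 F a);
  pf_mul_natr : forall (A B C : K) (g g' : hom1 B C) (f : hom1 A B)
    (b : hom2 g g'),
    pf2 F (b ▷ f) • pf_mul F g f = pf_mul F g' f • (pf2 F b ▷ pf1 F f);
  pf_mul_assoc : forall (A B C D : K) (h : hom1 C D) (g : hom1 B C)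
    (f : hom1 A B),
    pf2 F (asc h g f) • pf_mul F h (g ⊚ f) • (pf1 F h ◁ pf_mul F g f)
    = pf_mul F (h ⊚ g) f • (pf_mul F h g ▷ pf1 F f)
      • asc (pf1 F h) (pf1 F g) (pf1 F f);
  pf_mul_unitl : forall (A B : K) (f : hom1 A B),
    pf2 F (lun f) • pf_mul F (id1 B) f • (pf_unit F B ▷ pf1 F f)
    = lun (pf1 F f);
  pf_mul_unitr : forall (A B : K) (f : hom1 A B),
    pf2 F (run f) • pf_mul F f (id1 A) • (pf1 F f ◁ pf_unit F A)
    = run (pf1 F f) }.

Definition pf_idb (K : TwoCat) : PfBase K K :=
  {| pf0 := fun A => A; pf1 := fun A B f => f |}.

Definition pf_id (K : TwoCat) : PfData K K :=
  {| pf_base := pf_idb K;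
     pf2 := fun A B f g a => a;
     pf_unit := fun A => id2 (id1 A);
     pf_mul := fun A B C g f => id2 (g ⊚ f);
     pf_mulV := fun A B C g f => id2 (g ⊚ f) |}.

Definition pf_compb (K L M : TwoCat) (G : PfBase L M) (F : PfBase K L) :
  PfBase K M :=
  {| pf0 := fun A => G (F A); pf1 := fun A B f => pf1 G (pf1 F f) |}.

Definition pf_comp (K L M : TwoCat) (G : PfData L M) (F : PfData K L) :
  PfData K M :=
  {| pf_base := pf_compb G F;
     pf2 := fun A B f g a => pf2 G (pf2 F a);
     pf_unit := fun A => pf2 G (pf_unit F A) • pf_unit G (F A);
     pf_mul := fun A B C g f =>
       pf2 G (pf_mul F g f) • pf_mul G (pf1 F g) (pf1 F f);
     pf_mulV := fun A B C g f =>
       pf_mulV G (pf1 F g) (pf1 F f) • pf2 G (pf_mulV F g f) |}.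

Record PnData (K L : TwoCat) (F G : PfBase K L) := {
  pn1 :> forall A : K, hom1 (F A) (G A);
  pn2 : forall (A B : K) (f : hom1 A B),
    hom2 (pf1 G f ⊚ pn1 A) (pn1 B ⊚ pf1 F f) }.
Arguments pn2 {K L F G} s {A B} f : rename.

Record IsPseudonatural (K L : TwoCat) (F G : PfData K L) (s : PnData F G) :
  Prop := {
  pn2_iso : forall (A B : K) (f : hom1 A B), IsIso2 (pn2 s f);
  pn2_nat : forall (A B : K) (f g : hom1 A B) (a : hom2 f g),
    pn2 s g • (pf2 G a ▷ s A) = (s B ◁ pf2 F a) • pn2 s f;
  pn2_unit : forall A : K,
    pn2 s (id1 A) • (pf_unit G A ▷ s A) = (s A ◁ pf_unit F A) • lunr (s A);
  pn2_comp : forall (A B C : K) (g : hom1 B C) (f : hom1 A B),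
    pn2 s (g ⊚ f) • (pf_mul G g f ▷ s A)
    = (s C ◁ pf_mul F g f)
      • csa (s C) (pf1 F g) (pf1 F f)
      • (pn2 s g ▷ pf1 F f)
      • asc (pf1 G g) (s B) (pf1 F f)
      • (pf1 G g ◁ pn2 s f)
      • csa (pf1 G g) (pf1 G f) (s A) }.

(* Every naturality 2-cell is an identity. *)
Definition TwoNatural (K L : TwoCat) (F G : PfBase K L) (s : PnData F G) :
  Prop :=
  forall (A B : K) (f : hom1 A B),
  exists e : pf1 G f ⊚ s A = s B ⊚ pf1 F f, pn2 s f = eq2 e.

Definition pn_id (K L : TwoCat) (F : PfBase K L) : PnData F F :=
  {| pn1 := fun A => id1 (F A); pn2 := fun A B f => runl (pf1 F f) |}.

Definition pn_comp (K L : TwoCat) (F G H : PfBase K L)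
    (t : PnData G H) (s : PnData F G) : PnData F H :=
  {| pn1 := fun A => t A ⊚ s A;
     pn2 := fun A B f =>
       asc (t B) (s B) (pf1 F f)
       • (t B ◁ pn2 s f)
       • csa (t B) (pf1 G f) (s A)
       • (pn2 t f ▷ s A)
       • asc (pf1 H f) (t A) (s A) |}.

Definition pn_whiskl (K L M : TwoCat) (H : PfData L M) (F G : PfBase K L)
    (s : PnData F G) : PnData (pf_compb H F) (pf_compb H G) :=
  {| pn1 := fun A => pf1 H (s A) : hom1 (pf_compb H F A) (pf_compb H G A);
     pn2 := fun A B f =>
       pf_mulV H (s B) (pf1 F f) • pf2 H (pn2 s f) • pf_mul H (pf1 G f) (s A) |}.

Definition pn_whiskr (K L M : TwoCat) (F G : PfBase L M) (s : PnData F G)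
    (H : PfBase K L) : PnData (pf_compb F H) (pf_compb G H) :=
  {| pn1 := fun A => s (H A) : hom1 (pf_compb F H A) (pf_compb G H A);
     pn2 := fun A B f => pn2 s (pf1 H f) |}.

Record InvModif (K L : TwoCat) (F G : PfBase K L) (s t : PnData F G) := {
  im :> forall A : K, hom2 (s A) (t A);
  im_iso : forall A : K, IsIso2 (im A);
  im_nat : forall (A B : K) (f : hom1 A B),
    pn2 t f • (pf1 G f ◁ im A) = (im B ▷ pf1 F f) • pn2 s f }.

(* Two coherence axioms, dual to those of a pseudomonad; the other unit
   conditions follow from them. *)
Record PseudoComonad (K : TwoCat) (W : PfData K K) := {
  pc_pf : IsPseudofunctor W;
  pc_eps : PnData W (pf_id K);
  pc_eps_pn : @IsPseudonatural K K W (pf_id K) pc_eps;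
  pc_del : PnData W (pf_comp W W);
  pc_del_pn : @IsPseudonatural K K W (pf_comp W W) pc_del;
  (* W delta . delta ~ delta W . delta *)
  pc_assoc : @InvModif K K W (pf_compb W (pf_compb W W))
    (pn_comp (pn_whiskl W pc_del) pc_del)
    (pn_comp (pn_whiskr pc_del W) pc_del);
  (* eps W . delta ~ id *)
  pc_lunit : @InvModif K K W W (pn_comp (pn_whiskr pc_eps W) pc_del) (pn_id W);
  (* W eps . delta ~ id *)
  pc_runit : @InvModif K K W W (pn_comp (pn_whiskl W pc_eps) pc_del) (pn_id W);
  (* both sides : W (W delta) . (W delta . delta) => (delta WW . delta W) . delta *)
  pc_pentagon : forall A : K,
    let d := pc_del A in let dW := pc_del (W A) in let dWW := pc_del (W (W A)) in
    (pc_assoc (W A) ▷ d)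
    • asc (pf1 W dW) dW d
    • (pf1 W dW ◁ pc_assoc A)
    • csa (pf1 W dW) (pf1 W d) d
    • (pf_mulV W dW d ▷ d)
    • (pf2 W (pc_assoc A) ▷ d)
    • (pf_mul W (pf1 W d) d ▷ d)
    • asc (pf1 W (pf1 W d)) (pf1 W d) d
    = asc dWW dW d
    • (dWW ◁ pc_assoc A)
    • csa dWW (pf1 W d) d
    • (pn2 pc_del d ▷ d)
    • asc (pf1 W (pf1 W d)) dW d
    • (pf1 W (pf1 W d) ◁ pc_assoc A);
  (* both sides : W (eps W) . (W delta . delta) => W id . delta *)
  pc_triangle : forall A : K,
    let d := pc_del A in let dW := pc_del (W A) in let eW := pc_eps (W A) in
    (pf_unit W (W A) ▷ d)
    • (pc_runit (W A) ▷ d)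
    • asc (pf1 W eW) dW d
    • (pf1 W eW ◁ pc_assoc A)
    = (pf2 W (pc_lunit A) ▷ d)
    • (pf_mul W eW d ▷ d)
    • asc (pf1 W eW) (pf1 W d) d }.

(* Normal: the counit law holds strictly. *)
Record NormalPseudoCoalgebra (K : TwoCat) (W : PfData K K) (P : PseudoComonad W)
    (A : K) := {
  ca_map : hom1 A (W A);
  ca_counit : pc_eps P A ⊚ ca_map = id1 A;
  ca_cell : hom2 (pf1 W ca_map ⊚ ca_map) (pc_del P A ⊚ ca_map);
  ca_cell_iso : IsIso2 ca_cell;
  (* both sides : W (W l) . (W l . l) => (delta W . delta) . l *)
  ca_pentagon :
    let l := ca_map in let d := pc_del P A in let dW := pc_del P (W A) in
    (pc_assoc P A ▷ l)
    • asc (pf1 W d) d l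
    • (pf1 W d ◁ ca_cell)
    • csa (pf1 W d) (pf1 W l) l
    • (pf_mulV W d l ▷ l)
    • (pf2 W ca_cell ▷ l)
    • (pf_mul W (pf1 W l) l ▷ l)
    • asc (pf1 W (pf1 W l)) (pf1 W l) l
    = asc dW d l
    • (dW ◁ ca_cell)
    • csa dW (pf1 W l) l
    • (pn2 (pc_del P) l ▷ l)
    • asc (pf1 W (pf1 W l)) d l
    • (pf1 W (pf1 W l) ◁ ca_cell);
  (* both sides : W eps . (W l . l) => W id . l *)
  ca_triangle :
    let l := ca_map in let d := pc_del P A in let e := pc_eps P A in
    (pf_unit W A ▷ l)
    • (pc_runit P A ▷ l)
    • asc (pf1 W e) d l
    • (pf1 W e ◁ ca_cell)
    = (pf2 W (eq2 ca_counit) ▷ l)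
    • (pf_mul W e l ▷ l)
    • asc (pf1 W e) (pf1 W l) l }.

Record ClIdl := {
  cl_cat :> Cat;
  cl_idl : Ideal cl_cat;
  cl_closed : ClosedIdeal cl_idl;
  cl_ker : HasKernels cl_idl;
  cl_coker : HasCokernels cl_idl }.

Definition PreservesExact (C D : ClIdl) (F : Functor C D) : Prop :=
  forall (X Y Z : C) (f : Hom X Y) (g : Hom Y Z),
  Exact (cl_idl C) f g -> Exact (cl_idl D) (fmap F f) (fmap F g).

Record ExFunctor (C D : ClIdl) := MkExFunctor {
  exf :> Functor C D;
  exf_exact : PreservesExact exf }.

Definition eqhom (C : Cat) (A B : C) (e : A = B) : Hom A B :=
  match e with eq_refl => idm A end.

Lemma eqhom_id (C : Cat) (A : C) (e : A = A) : eqhom e = idm A.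
Proof. by rewrite (proof_irrelevance _ e eq_refl). Qed.

Lemma functor_ext (C D : Cat) (F G : Functor C D) (e : forall X, F X = G X) :
  (forall (X Y : C) (f : Hom X Y),
     eqhom (e Y) ∘ fmap F f = fmap G f ∘ eqhom (e X)) -> F = G.
Proof.
case: F e => Fo Fm F1 F2; case: G => Go Gm G1 G2 /= e.
have E : Fo = Go by apply: functional_extensionality_dep.
subst Go => H.
have Em : Fm = Gm.
  do 2 (apply: functional_extensionality_dep => ?).
  apply: functional_extensionality_dep => f.
  by have := H _ _ f; rewrite !eqhom_id cmp1m cmpm1.
by subst Gm; f_equal; apply: proof_irrelevance.
Qed.

Lemma exf_ext (C D : ClIdl) (F G : ExFunctor C D) : exf F = exf G -> F = G.
Proof.
case: F G => [F Fe] [G Ge] /= E; subst G.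
by f_equal; apply: proof_irrelevance.
Qed.

Lemma exf_ext_strict (C D : ClIdl) (F G : ExFunctor C D) :
  existT (fun o : C -> D => forall A B : C, Hom A B -> Hom (o A) (o B))
    (fob F) (fun A B => fmap F)
  = existT _ (fob G) (fun A B => fmap G) -> F = G.
Proof.
move=> H; apply: exf_ext; case: F G H => [[Fo Fm F1 F2] Fe] [[Go Gm G1 G2] Ge].
move=> /= H; have E := eq_sigT_fst H; rewrite /= in E; subst Go.
have Em : Fm = Gm.
  exact: (inj_pairT2 _ _ _ _ _ H).
by subst Gm; f_equal; apply: proof_irrelevance.
Qed.

Definition exf_id (C : ClIdl) : ExFunctor C C :=
  MkExFunctor (exf := functor_id C) (fun X Y Z f g e => e).

Definition exf_comp (C D E : ClIdl) (G : ExFunctor D E) (F : ExFunctor C D) :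
  ExFunctor C E :=
  MkExFunctor (exf := functor_comp G F)
    (fun X Y Z f g e => exf_exact G (exf_exact F e)).

Definition nt_id (C D : Cat) (F : Functor C D) : NatTrans F F.
Proof.
refine {| nt := fun X => idm (F X) |}.
by move=> X Y f; rewrite cmp1m cmpm1.
Defined.

Definition nt_comp (C D : Cat) (F G H : Functor C D)
  (b : NatTrans G H) (a : NatTrans F G) : NatTrans F H.
Proof.
refine {| nt := fun X => b X ∘ a X |}.
by move=> X Y f; rewrite -cmpA nt_nat cmpA nt_nat cmpA.
Defined.

Definition nt_whiskl (C D E : Cat) (H : Functor D E) (F G : Functor C D)
  (a : NatTrans F G) : NatTrans (functor_comp H F) (functor_comp H G).
Proof.
refine {| nt := fun X =>
  fmap H (a X) : Hom (functor_comp H F X) (functor_comp H G X) |}.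
by move=> X Y f; rewrite /= -!fmapM nt_nat.
Defined.

Definition nt_whiskr (C D E : Cat) (F G : Functor D E) (a : NatTrans F G)
  (H : Functor C D) : NatTrans (functor_comp F H) (functor_comp G H).
Proof.
refine {| nt := fun X =>
  a (H X) : Hom (functor_comp F H X) (functor_comp G H X) |}.
by move=> X Y f; rewrite /= nt_nat.
Defined.

Definition ClIdlExData : TwoCatData :=
  {| ob0 := ClIdl;
     hom1 := ExFunctor;
     hom2 := fun C D F G => NatTrans F G;
     id1 := exf_id;
     comp1 := exf_comp;
     id2 := fun C D F => nt_id F;
     comp2 := fun C D F G H b a => nt_comp b a;
     whiskl := fun C D E H F G a => nt_whiskl H a;
     whiskr := fun C D E F G a H => nt_whiskr a H |}.

Lemma eq2_nt (C D : ClIdlExData) (F G : hom1 C D) (e : F = G) (X : cl_cat C) :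
  nt (eq2 e) X = eqhom (f_equal (fun H : ExFunctor C D => H X) e).
Proof. by subst G. Qed.

Definition ClIdlEx : TwoCat.
Proof.
unshelve refine {| tc_data := ClIdlExData |}.
- move=> A B C D h g f; exact: exf_ext_strict.
- move=> A B f; exact: exf_ext_strict.
- move=> A B f; exact: exf_ext_strict.
- by move=> *; apply: nt_ext => X /=; rewrite cmpA.
- by move=> *; apply: nt_ext => X /=; rewrite cmp1m.
- by move=> *; apply: nt_ext => X /=; rewrite cmpm1.
- by move=> *; apply: nt_ext => X /=; rewrite fmap1.
- by move=> *; apply: nt_ext => X /=; rewrite fmapM.
- by move=> *; apply: nt_ext => X /=.
- by move=> *; apply: nt_ext => X /=.
- by move=> *; apply: nt_ext => X /=; rewrite nt_nat.
- move=> A B f g a; apply: nt_ext => X.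
  rewrite /comp2 /= !eq2_nt !eqhom_id.
  by rewrite /= cmp1m cmpm1.
- move=> A B f g a; apply: nt_ext => X.
  rewrite /comp2 /= !eq2_nt !eqhom_id.
  by rewrite /= cmp1m cmpm1.
- move=> *; apply: nt_ext => X.
  rewrite /comp2 /= !eq2_nt !eqhom_id.
  by rewrite /= cmp1m cmpm1.
- move=> *; apply: nt_ext => X.
  rewrite /comp2 /= !eq2_nt !eqhom_id.
  by rewrite /= cmp1m cmpm1.
- move=> *; apply: nt_ext => X.
  rewrite /comp2 /= !eq2_nt !eqhom_id.
  by rewrite /= cmp1m cmpm1.
Defined.

(* Chosen kernels and cokernels, and a chosen replacement of every exact
   sequence, a short exact sequence being its own replacement. *)
Record Choice := {
  ch_ker : forall (C : ClIdl) (A B : C) (f : Hom A B), Kernel (cl_idl C) f;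
  ch_coker : forall (C : ClIdl) (A B : C) (f : Hom A B), Cokernel (cl_idl C) f;
  ch_rep : forall (C : ClIdl) (X Y Z : C) (f : Hom X Y) (g : Hom Y Z),
    Exact (cl_idl C) f g -> Replacement (cl_idl C) f g;
  ch_rep_ses : forall (C : ClIdl) (S : SesOb (cl_idl C))
    (e : Exact (cl_idl C) (sf S) (sg S)), rep_ses (ch_rep e) = S }.

Lemma choice_exists : inhabited Choice.
Proof.
have K (C : ClIdl) (A B : C) (f : Hom A B) : inhabited (Kernel (cl_idl C) f).
  by case: (cl_ker f) => X [k kP]; constructor; exists X k.
have Q (C : ClIdl) (A B : C) (f : Hom A B) : inhabited (Cokernel (cl_idl C) f).
  by case: (cl_coker f) => X [k kP]; constructor; exists X k.
have R (C : ClIdl) (X Y Z : C) (f : Hom X Y) (g : Hom Y Z) :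
    Exact (cl_idl C) f g -> {R : Replacement (cl_idl C) f g |
      forall s : ShortExact (cl_idl C) f g, rep_ses R = MkSes s}.
  move=> e; apply: constructive_indefinite_description.
  case: (classic (ShortExact (cl_idl C) f g)) => [s | ns].
    exists (self_replacement s) => s'.
    by rewrite /rep_ses /=; f_equal; apply: proof_irrelevance.
  by case: e => _ [R]; exists R => s; case: (ns s).
constructor; unshelve refine {|
  ch_ker := fun C A B f => epsilon (K C A B f) (fun _ => True);
  ch_coker := fun C A B f => epsilon (Q C A B f) (fun _ => True);
  ch_rep := fun C X Y Z f g e => proj1_sig (R C X Y Z f g e) |}.
move=> C [X Y Z f g s] /= e; exact: (proj2_sig (R _ _ _ _ _ _ e)).
Qed.

Definition SesCl (C : ClIdl) : ClIdl :=
  {| cl_cat := Ses (cl_idl C);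
     cl_idl := SesIdeal (cl_idl C);
     cl_closed := ses_closed (@cl_closed C);
     cl_ker := ses_has_kernels (@cl_closed C) (@cl_ker C) (@cl_coker C);
     cl_coker := ses_has_cokernels (@cl_closed C) (@cl_ker C) (@cl_coker C) |}.

Lemma ses_clP (C : ClIdl) (S T U : SesCl C) (m : Hom S T) (n : Hom T U) :
  Exact (cl_idl (SesCl C)) m n <-> Exact (cl_idl C) (mv m) (mv n).
Proof.
exact: (ses_exactP (@cl_closed C) (@cl_ker C) (@cl_coker C)).
Qed.

Definition eps_functor (C : ClIdl) : Functor (SesCl C) C :=
  {| fob := fun S : SesCl C => sY S;
     fmap := fun (S S' : SesCl C) (m : Hom S S') => mv m;
     fmap1 := fun _ => eq_refl;
     fmapM := fun _ _ _ _ _ => eq_refl |}.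

Definition epsilon1 (C : ClIdlEx) : hom1 (SesCl C : ClIdlEx) C :=
  MkExFunctor (exf := eps_functor C)
    (fun S T U m n e => proj1 (ses_clP m n) e).

Section RepLift.
Variables (C : Cat) (N : Ideal C).

Lemma rep_lift_null (X Y Z X' Y' Z' : C) (f : Hom X Y) (g : Hom Y Z)
  (f' : Hom X' Y') (g' : Hom Y' Z') (R : Replacement N f g)
  (R' : Replacement N f' g') (v : Hom Y Y') :
  null N (g' ∘ v ∘ rep_ker R) ->
  null N (sg (rep_ses R') ∘ v ∘ sf (rep_ses R)).
Proof.
move=> n; exact: (ses_null_factor (S := rep_ses R')
  (kfacE (rep_ker_is R') n)).
Qed.

Lemma rep_lift_sq (X Y Z X' Y' Z' : C) (f : Hom X Y) (g : Hom Y Z)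
  (f' : Hom X' Y') (g' : Hom Y' Z') (R : Replacement N f g)
  (R' : Replacement N f' g') (v : Hom Y Y') (w : Hom Z Z') :
  w ∘ g = g' ∘ v -> null N (sg (rep_ses R') ∘ v ∘ sf (rep_ses R)).
Proof.
move=> E; apply: rep_lift_null; rewrite cmpA -E -cmpA; apply: null_post.
by case: (rep_ker_is R).
Qed.

End RepLift.

Section Omega.
Variable ch : Choice.

Section OnFunctors.
Variables (C D : ClIdl) (G : ExFunctor C D).

Lemma om_exact (S : SesCl C) :
  Exact (cl_idl D) (fmap G (sf S)) (fmap G (sg S)).
Proof. exact: (exf_exact G (short_exact (s_short S))). Qed.

Definition om_rep (S : SesCl C) :
  Replacement (cl_idl D) (fmap G (sf S)) (fmap G (sg S)) :=
  ch_rep ch (om_exact S).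

Definition om_ob (S : SesCl C) : SesCl D := rep_ses (om_rep S).

Lemma om_null (S S' : SesCl C) (m : Hom S S') :
  null (cl_idl D) (sg (om_ob S') ∘ fmap G (mv m) ∘ sf (om_ob S)).
Proof.
have E : fmap G (mw m) ∘ fmap G (sg S) = fmap G (sg S') ∘ fmap G (mv m).
  by rewrite -!fmapM mwE.
exact: (rep_lift_sq (om_rep S) (om_rep S') E).
Qed.

Definition om_functor : Functor (SesCl C) (SesCl D).
Proof.
refine {| fob := om_ob;
  fmap := fun S S' m => ses_lift (om_null m) : Hom (om_ob S) (om_ob S') |}.
- by move=> S; apply: ses_hom_ext; rewrite /= fmap1.
- by move=> S T U n m; apply: ses_hom_ext; rewrite /= fmapM.
Defined.

Lemma om_functor_exact : PreservesExact (C := SesCl C) (D := SesCl D) om_functor.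
Proof.
move=> S T U m n /ses_clP e; apply/ses_clP; exact: (exf_exact G e).
Qed.

Definition om1 : ExFunctor (SesCl C) (SesCl D) := MkExFunctor om_functor_exact.
End OnFunctors.

Section On2Cells.
Variables (C D : ClIdl) (G H : ExFunctor C D) (a : NatTrans G H).

Lemma om2_null (S : SesCl C) :
  null (cl_idl D) (sg (om_ob H S) ∘ a (sY S) ∘ sf (om_ob G S)).
Proof. exact: (rep_lift_sq (om_rep G S) (om_rep H S) (nt_nat a (sg S))). Qed.

Definition om2 : NatTrans (om1 G) (om1 H).
Proof.
refine {| nt := fun S => ses_lift (om2_null S) : Hom (om1 G S) (om1 H S) |}.
by move=> S S' m; apply: ses_hom_ext; rewrite /= nt_nat.
Defined.
End On2Cells.

Lemma mv_eqhom (C : ClIdl) (S T : SesCl C) (e : S = T) :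
  mv (eqhom e) = eqhom (f_equal (@sY _ _) e).
Proof. by subst T. Qed.

Lemma om1_id (C : ClIdl) : exf_id (SesCl C) = om1 (exf_id C).
Proof.
have e (S : SesCl C) : S = om_ob (exf_id C) S by rewrite /om_ob ch_rep_ses.
apply: exf_ext.
apply: (@functor_ext _ _ (exf (exf_id (SesCl C))) (exf (om1 (exf_id C))) e).
move=> S S' m.
by apply: ses_hom_ext; rewrite /= !mv_eqhom !eqhom_id cmp1m cmpm1.
Qed.

Section Comparison.
Variables (C D E : ClIdl) (H : ExFunctor D E) (G : ExFunctor C D).

Lemma om_mul_null (S : SesCl C) :
  null (cl_idl E) (sg (om_ob (exf_comp H G) S) ∘ idm (H (G (sY S)))
    ∘ sf (om_ob H (om_ob G S))).
Proof.
set R := om_rep H (om_ob G S).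
apply: (rep_lift_null (R := R)); rewrite cmp1m.
have xE : fmap H (fmap G (sg S))
    = fmap H (rep_xi2 (om_rep G S)) ∘ fmap H (rep_coker (om_rep G S)).
  by rewrite -fmapM -rep_gE.
rewrite [X in X ∘ _]xE -cmpA; apply: null_post.
by case: (rep_ker_is R).
Qed.

Lemma om_mulV_null (S : SesCl C) :
  null (cl_idl E) (sg (om_ob H (om_ob G S)) ∘ idm (H (G (sY S)))
    ∘ sf (om_ob (exf_comp H G) S)).
Proof.
set R := om_rep (exf_comp H G) S.
apply: (rep_lift_null (R := R)); rewrite cmp1m.
have n : null (cl_idl E) (fmap H (sg (om_ob G S)) ∘ fmap H (fmap G (sf S))).
  have xE : fmap H (fmap G (sf S))
      = fmap H (rep_ker (om_rep G S)) ∘ fmap H (rep_xi1 (om_rep G S)).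
    by rewrite -fmapM -rep_fE.
  rewrite [X in _ ∘ X]xE cmpA; apply: null_pre.
  by case: (om_exact H (om_ob G S)).
exact: (ses_null_cofactor (S := rep_ses R) (cfacE (rep_coker_is R) n)).
Qed.

Definition om_mul : NatTrans (functor_comp (om1 H) (om1 G)) (om1 (exf_comp H G)).
Proof.
refine {| nt := fun S => ses_lift (om_mul_null S) :
  Hom (functor_comp (om1 H) (om1 G) S) (om1 (exf_comp H G) S) |}.
by move=> S S' m; apply: ses_hom_ext; rewrite /= cmp1m cmpm1.
Defined.

Definition om_mulV : NatTrans (om1 (exf_comp H G)) (functor_comp (om1 H) (om1 G)).
Proof.
refine {| nt := fun S => ses_lift (om_mulV_null S) :
  Hom (om1 (exf_comp H G) S) (functor_comp (om1 H) (om1 G) S) |}.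
by move=> S S' m; apply: ses_hom_ext; rewrite /= cmp1m cmpm1.
Defined.
End Comparison.

(* pf_unit is the identity: Omega preserves identity 1-cells strictly. *)
Definition Omega : PfData ClIdlEx ClIdlEx :=
  {| pf_base := {| pf0 := SesCl : ClIdlEx -> ClIdlEx;
                   pf1 := fun C D G => om1 G |};
     pf2 := fun C D G H a => om2 a;
     pf_unit := fun C => eq2 (K := ClIdlEx) (om1_id C);
     pf_mul := fun C D E H G => om_mul H G;
     pf_mulV := fun C D E H G => om_mulV H G |}.

Section Delta.
Variable C : ClIdl.

Let N := cl_idl C.
Notation ck A := (ch_coker ch (idm A)).
Notation kk A := (ch_ker ch (idm A)).

Definition top_row (A : C) : SesCl C :=
  MkSes (id_coker_short (coker_is (ck A))).

Definition bot_row (A : C) : SesCl C :=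
  MkSes (id_ker_short (ker_is (kk A))).

Lemma ck_null (A H : C) (h : Hom A H) : null N h -> null N (h ∘ idm A).
Proof. by rewrite cmpm1. Qed.

Lemma kk_null (A H : C) (h : Hom H A) : null N h -> null N (idm A ∘ h).
Proof. by rewrite cmp1m. Qed.

Lemma coker_id_null (A : C) : null N (coker (ck A)).
Proof. by rewrite -(cmpm1 (coker _)); case: (coker_is (ck A)). Qed.

Lemma ker_id_null (A : C) : null N (ker (kk A)).
Proof. by rewrite -(cmp1m (ker _)); case: (ker_is (kk A)). Qed.

Definition del_top_mor (S : SesCl C) : Hom (top_row (sX S)) S.
Proof.
apply: (@MkSesHom _ _ (top_row (sX S)) S (idm (sX S)) (sf S)
  (cfac (coker_is (ck (sX S))) (ck_null (ses_null S)))).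
- by [].
- by rewrite /= -cfacE.
Defined.

Definition del_bot_mor (S : SesCl C) : Hom S (bot_row (sZ S)).
Proof.
apply: (@MkSesHom _ _ S (bot_row (sZ S))
  (kfac (ker_is (kk (sZ S))) (kk_null (ses_null S))) (sg S) (idm (sZ S))).
- by rewrite /= -kfacE.
- by [].
Defined.

Lemma del_short (S : SesCl C) :
  ShortExact (cl_idl (SesCl C)) (del_top_mor S) (del_bot_mor S).
Proof.
split.
- apply: (ses_isker (@cl_closed C)) => /=; first by case: (s_short S).
  apply: IsKernelP; first by rewrite cmpm1; apply: ses_null.
  + by move=> H a b; rewrite !cmp1m.
  + by move=> H h _; exists h; rewrite cmp1m.
- apply: (ses_iscoker (@cl_closed C)) => /=; first by case: (s_short S).
  apply: IsCokernelP; first by rewrite cmp1m; apply: ses_null.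
  + by move=> H a b; rewrite !cmpm1.
  + by move=> H h _; exists h; rewrite cmpm1.
Qed.

Definition del_ob (S : SesCl C) : SesCl (SesCl C) := MkSes (del_short S).

Lemma top_null (A B : C) (u : Hom A B) : null N ((coker (ck B) ∘ u) ∘ idm A).
Proof. by do 2 apply: null_pre; apply: coker_id_null. Qed.

Lemma bot_null (A B : C) (w : Hom A B) : null N (idm B ∘ (w ∘ ker (kk A))).
Proof. by do 2 apply: null_post; apply: ker_id_null. Qed.

Definition top_hom (A B : C) (u : Hom A B) : Hom (top_row A) (top_row B).
Proof.
apply: (@MkSesHom _ _ (top_row A) (top_row B) u u
  (cfac (coker_is (ck A)) (top_null u))).
- by rewrite /= cmp1m cmpm1.
- by rewrite /= -cfacE.
Defined.

Definition bot_hom (A B : C) (w : Hom A B) : Hom (bot_row A) (bot_row B).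
Proof.
apply: (@MkSesHom _ _ (bot_row A) (bot_row B)
  (kfac (ker_is (kk B)) (bot_null w)) w w).
- by rewrite /= -kfacE.
- by rewrite /= cmp1m cmpm1.
Defined.

Definition del_hom (S S' : SesCl C) (m : Hom S S') : Hom (del_ob S) (del_ob S').
Proof.
apply: (@MkSesHom _ _ (del_ob S) (del_ob S')
  (top_hom (mu m)) m (bot_hom (mw m))); apply: ses_hom_ext.
- exact: (muE m).
- exact: (mwE m).
Defined.

Definition del_functor : Functor (SesCl C) (SesCl (SesCl C)).
Proof.
refine {| fob := del_ob; fmap := del_hom |}.
- by move=> S; apply: ses_hom_ext.
- by move=> S T U n m; apply: ses_hom_ext.
Defined.

Lemma del_exact :
  PreservesExact (C := SesCl C) (D := SesCl (SesCl C)) del_functor.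
Proof. by move=> S T U m n e; apply/ses_clP. Qed.

End Delta.

Definition delta1 (C : ClIdlEx) : hom1 (Omega C) (Omega (Omega C)) :=
  MkExFunctor (@del_exact C).

End Omega.

Definition TFIdeal (C : Cat) (T F : C -> Prop) : Ideal C.
Proof.
refine (@Build_Ideal C (fun A B f =>
  exists (P : C) (b : Hom P B) (a : Hom A P), T P /\ F P /\ f = b ∘ a) _ _).
- move=> X Y Z g f [P [b [a [t [t' ->]]]]]; exists P, (g ∘ b), a.
  by rewrite cmpA.
- move=> X Y Z g f [P [b [a [t [t' ->]]]]]; exists P, b, (a ∘ f).
  by rewrite cmpA.
Defined.

Record TorsionSeq (C : Cat) (T F : C -> Prop) (X : C) := {
  ts_T : C; ts_F : C;
  ts_l : Hom ts_T X;
  ts_r : Hom X ts_F;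
  ts_inT : T ts_T;
  ts_inF : F ts_F;
  ts_short : ShortExact (TFIdeal T F) ts_l ts_r }.

(* The full subcategories are given by their classes of objects. *)
Record IsPretorsionTheory (C : Cat) (T F : C -> Prop) : Prop := {
  pt_T_replete : forall (A B : C) (f : Hom A B), IsIso f -> T A -> T B;
  pt_F_replete : forall (A B : C) (f : Hom A B), IsIso f -> F A -> F B;
  pt_hom_null : forall (A B : C) (f : Hom A B),
    T A -> F B -> null (TFIdeal T F) f;
  pt_seq : forall X : C, inhabited (TorsionSeq T F X) }.

Lemma TFIdeal_closed (C : Cat) (T F : C -> Prop) : ClosedIdeal (TFIdeal T F).
Proof.
move=> X Y f [P [b [a [t [t' ->]]]]]; exists P, b, a; split=> //.
by exists P, (idm P), (idm P); rewrite cmp1m.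
Qed.

Section Lambda.
Variables (C : Cat) (T F : C -> Prop) (pt : IsPretorsionTheory T F).
Variables (hk : HasKernels (TFIdeal T F)) (hc : HasCokernels (TFIdeal T F)).
Variable ts : forall X : C, TorsionSeq T F X.

Definition TFClIdl : ClIdl :=
  {| cl_cat := C; cl_idl := TFIdeal T F; cl_closed := @TFIdeal_closed C T F;
     cl_ker := hk; cl_coker := hc |}.

Definition lam_ob (X : TFClIdl) : SesCl TFClIdl := MkSes (ts_short (ts X)).

Lemma lam_null (X Y : TFClIdl) (h : Hom X Y) :
  null (TFIdeal T F) (ts_r (ts Y) ∘ h ∘ ts_l (ts X)).
Proof. exact: (pt_hom_null pt _ (ts_inT (ts X)) (ts_inF (ts Y))). Qed.

Definition lam_hom (X Y : TFClIdl) (h : Hom X Y) : Hom (lam_ob X) (lam_ob Y) :=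
  ses_lift (S := lam_ob X) (S' := lam_ob Y) (lam_null h).

Definition lam_functor : Functor TFClIdl (SesCl TFClIdl).
Proof.
refine {| fob := lam_ob; fmap := lam_hom |}.
- by move=> X; apply: ses_hom_ext.
- by move=> X Y Z g f; apply: ses_hom_ext.
Defined.

Lemma lam_exact : PreservesExact (C := TFClIdl) (D := SesCl TFClIdl) lam_functor.
Proof. by move=> X Y Z f g e; apply/ses_clP. Qed.

Definition lambda1 : ExFunctor TFClIdl (SesCl TFClIdl) := MkExFunctor lam_exact.

End Lambda.

(* Main.v *)
Require Import Defs.
From Stdlib Require Import ssreflect ProofIrrelevance.
Set Implicit Arguments.
Unset Strict Implicit.
Unset Printing Implicit Defensive.

(** A morphism of short exact sequences is determined by its middle component,
    and a morphism [v] of middle objects extends to one from [S] to [S'] as soon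
    as [sg S' ∘ v ∘ sf S] is null.  In other words the counit
    [epsilon : Ses C -> C] is faithful, and its image on each hom-set is cut out
    by a nullity condition.

    The naturality of the counit and the left counit law are strict equalities
    of functors.  Every other structural 2-cell of the pseudo-comonad and of the
    coalgebra of a pretorsion theory relates two functors into some [Ses D] with
    the same middle objects, and is the extension of the identities of these
    objects.  It exists and is invertible because a short exact sequence is
    compared with the chosen replacement of an exact sequence with the same
    middle object: the kernel of [g] is killed by [g], and the cokernel of [f]
    kills [f].  These two facts, [om_ker_null] and [om_coker_null], are what
    [mid_cell] and [mid_cell_iso] need for the naturality of the
    comultiplication, coassociativity, the right counit law and the coalgebra
    cell.  Naturality in an arbitrary 2-cell is read off on middle components.

    Coherence then costs nothing: apply a composite [E] of counits that goes
    down far enough.  Each factor of each side becomes a family of identity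
    morphisms, up to equality of objects, hence so does each side; such families
    are unique, and [E] is faithful ([over_uniq]).  The predicate [Over E a] says
    that [E ◁ a] is such a family, and the rules for it follow the ways in which
    2-cells are built; a whiskering on the left is absorbed into [E], since
    [E ⊚ epsilon ⊚ Omega G] is [E ⊚ G ⊚ epsilon], and
    [epsilon ⊚ delta] is the identity. *)

(** * Identities up to equality of objects *)

(** The two objects are kept apart because the functors compared below agree on
    objects only after computation, and only propositionally in the strict unit
    law of the pseudofunctor. *)
Definition IdLike (C : Cat) (A B : C) (f : Hom A B) : Prop :=
  exists e : A = B, f = eqhom e.

Lemma idlike_uniq (C : Cat) (A B : C) (f g : Hom A B) :
  IdLike f -> IdLike g -> f = g.
Proof. by move=> [e ->] [e' ->]; rewrite (proof_irrelevance _ e e'). Qed.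

Lemma idlike_idm (C : Cat) (A : C) : IdLike (idm A).
Proof. by exists eq_refl. Qed.

Lemma idlike_cmp (C : Cat) (X Y Z : C) (g : Hom Y Z) (f : Hom X Y) :
  IdLike g -> IdLike f -> IdLike (g ∘ f).
Proof.
by move=> [e ->] [e' ->]; subst Y Z; exists eq_refl; apply: cmp1m.
Qed.

Lemma idlike_fmap (C D : Cat) (F : Functor C D) (X Y : C) (f : Hom X Y) :
  IdLike f -> IdLike (fmap F f).
Proof. by move=> [e ->]; subst Y; exists eq_refl; apply: fmap1. Qed.

Lemma eqhom_sym (C : Cat) (A B : C) (e : A = B) :
  eqhom (eq_sym e) ∘ eqhom e = idm A /\ eqhom e ∘ eqhom (eq_sym e) = idm B.
Proof. by subst B; rewrite cmp1m. Qed.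

(** * 2-cells lying over identities *)

Definition Faithful (C D : Cat) (E : Functor C D) : Prop :=
  forall (A B : C) (f g : Hom A B), fmap E f = fmap E g -> f = g.

Lemma id_faithful (C : ClIdlEx) : Faithful (exf (id1 C)).
Proof. by []. Qed.

Lemma eps_comp_faithful (C D : ClIdlEx) (E : hom1 C D) :
  Faithful (exf E) -> Faithful (exf (E ⊚ epsilon1 C)).
Proof. by move=> fE A B f g /fE; apply: ses_hom_ext. Qed.

Definition Over (C D E0 : ClIdlEx) (E : hom1 D E0) (F G : hom1 C D)
  (a : hom2 F G) : Prop :=
  forall X : cl_cat C, IdLike (fmap (exf E) (nt a X)).

(** The principle by which all coherence axioms are proved. *)
Lemma over_uniq (C D E0 : ClIdlEx) (E : hom1 D E0) (F G : hom1 C D)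
  (a b : hom2 F G) : Faithful (exf E) -> Over E a -> Over E b -> a = b.
Proof.
by move=> fE oa ob; apply: nt_ext => X; apply: fE; apply: idlike_uniq.
Qed.

Section OverCalculus.
Variables (C D E0 : ClIdlEx) (E : hom1 D E0).

Lemma over_comp2 (F G H : hom1 C D) (b : hom2 G H) (a : hom2 F G) :
  Over E b -> Over E a -> Over E (b • a).
Proof. by move=> ob oa X; rewrite /= fmapM; apply: idlike_cmp. Qed.

Lemma over_eq2 (F G : hom1 C D) (e : F = G) : Over E (eq2 e).
Proof. by move=> X; apply: idlike_fmap; rewrite eq2_nt; eexists. Qed.

Lemma over_whiskl (B : ClIdlEx) (h : hom1 C D) (F G : hom1 B C)
  (a : hom2 F G) : Over (E ⊚ h) a -> Over E (h ◁ a).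
Proof. by []. Qed.

Lemma over_whiskr (B : ClIdlEx) (F G : hom1 C D) (a : hom2 F G)
  (h : hom1 B C) : Over E a -> Over E (a ▷ h).
Proof. by move=> o X; apply: o. Qed.

Lemma over_mid (F G : hom1 C (SesCl D : ClIdlEx)) (a : hom2 F G) :
  (forall X : cl_cat C, IdLike (mv (nt a X))) -> Over (E ⊚ epsilon1 D) a.
Proof. by move=> o X; exact: (idlike_fmap (exf E) (o X)). Qed.
End OverCalculus.

Section OverStrictness.
Variables (A B C D E0 : ClIdlEx).
Variables (h : hom1 C D) (g : hom1 B C) (f : hom1 A B).

Lemma over_asc (E : hom1 D E0) : Over E (asc h g f).
Proof. exact: over_eq2. Qed.

Lemma over_csa (E : hom1 D E0) : Over E (csa h g f).
Proof. exact: over_eq2. Qed.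

Variable E : hom1 B E0.

Lemma over_lun : Over E (lun f).
Proof. exact: over_eq2. Qed.

Lemma over_run : Over E (run f).
Proof. exact: over_eq2. Qed.

Lemma over_lunr : Over E (lunr f).
Proof. exact: over_eq2. Qed.

Lemma over_runl : Over E (runl f).
Proof. exact: over_eq2. Qed.
End OverStrictness.

Lemma eq2_iso (K : TwoCat) (A B : K) (f g : hom1 A B) (e : f = g) :
  IsIso2 (eq2 e).
Proof. by case: g / e; exists (id2 f); rewrite comp2_idl. Qed.

(** * 2-cells extending identities of middle objects *)

Lemma nt_mid_ext (B C : Cat) (N : Ideal C) (F G : Functor B (Ses N))
  (a b : NatTrans F G) : (forall X, mv (a X) = mv (b X)) -> a = b.
Proof. by move=> E; apply: nt_ext => X; apply: ses_hom_ext. Qed.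

Section MidCell.
Variables (B C : ClIdlEx) (F G : hom1 B (SesCl C : ClIdlEx)).
Variable e : forall X : cl_cat B, sY (exf F X) = sY (exf G X).
Hypothesis e_nat : forall (X Y : cl_cat B) (f : Hom X Y),
  eqhom (e Y) ∘ mv (fmap (exf F) f) = mv (fmap (exf G) f) ∘ eqhom (e X).
Hypothesis e_null : forall X : cl_cat B,
  null (cl_idl C) (sg (exf G X) ∘ eqhom (e X) ∘ sf (exf F X)).

Definition mid_cell : hom2 F G.
Proof.
refine {| nt := fun X => ses_lift (e_null X) : Hom (exf F X) (exf G X) |}.
by move=> X Y f; apply: ses_hom_ext; apply: e_nat.
Defined.

Lemma over_mid_cell (E0 : ClIdlEx) (E : hom1 C E0) :
  Over (E ⊚ epsilon1 C) mid_cell.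
Proof. by apply: over_mid => X; exists (e X). Qed.
End MidCell.
Arguments mid_cell {B C} F G e.

(** The inverse extends the inverse identities; their naturality is automatic,
    so that only the nullity condition has to be checked a second time. *)
Lemma mid_cell_iso (B C : ClIdlEx) (F G : hom1 B (SesCl C : ClIdlEx))
  (e : forall X : cl_cat B, sY (exf F X) = sY (exf G X)) e_nat e_null :
  (forall X : cl_cat B,
   null (cl_idl C) (sg (exf F X) ∘ eqhom (eq_sym (e X)) ∘ sf (exf G X))) ->
  IsIso2 (mid_cell F G e e_nat e_null).
Proof.
move=> e_nullV.
have e_natV (X Y : cl_cat B) (f : Hom X Y) :
    eqhom (eq_sym (e Y)) ∘ mv (fmap (exf G) f)
    = mv (fmap (exf F) f) ∘ eqhom (eq_sym (e X)).
  case: (eqhom_sym (e X)) (eqhom_sym (e Y)) => [_ eX] [eY _].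
  rewrite -[LHS]cmpm1 -eX -!cmpA (cmpA (mv _)) -e_nat -!cmpA.
  by rewrite (cmpA (eqhom (eq_sym (e Y)))) eY cmp1m.
by exists (mid_cell G F _ e_natV e_nullV); split; apply: nt_mid_ext => X;
  case: (eqhom_sym (e X)).
Qed.

Section Omega.
Variable ch : Choice.
Notation W := (Omega ch).

(** * Nullity along chosen replacements *)

Section ReplacementNull.
Variables (C D : ClIdl) (G : ExFunctor C D) (S : SesCl C).

Lemma om_ker_null : null (cl_idl D) (fmap G (sg S) ∘ sf (om_ob ch G S)).
Proof. by case: (rep_ker_is (om_rep ch G S)). Qed.

Lemma om_coker_null : null (cl_idl D) (sg (om_ob ch G S) ∘ fmap G (sf S)).
Proof. by case: (rep_coker_is (om_rep ch G S)). Qed.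

(** A morphism killed by [G g] factors through the kernel of [G g], which is
    the first half of the replacement. *)
Lemma om_sg_null (A : D) (h : Hom A (G (sY S))) :
  null (cl_idl D) (fmap G (sg S) ∘ h) ->
  null (cl_idl D) (sg (om_ob ch G S) ∘ h).
Proof.
move=> n; exact: (ses_null_factor (S := om_ob ch G S)
  (kfacE (rep_ker_is (om_rep ch G S)) n)).
Qed.

Lemma om_sf_null (A : D) (h : Hom (G (sY S)) A) :
  null (cl_idl D) (h ∘ fmap G (sf S)) ->
  null (cl_idl D) (h ∘ sf (om_ob ch G S)).
Proof.
move=> n; exact: (ses_null_cofactor (S := om_ob ch G S)
  (cfacE (rep_coker_is (om_rep ch G S)) n)).
Qed.
End ReplacementNull.

(** * Counit and comultiplication *)

Lemma eps_nat (C D : ClIdlEx) (G : hom1 C D) :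
  G ⊚ epsilon1 C = epsilon1 D ⊚ pf1 W G.
Proof. exact: exf_ext_strict. Qed.

Definition eps_pn : PnData W (pf_id ClIdlEx) :=
  {| pn1 := epsilon1 : forall C, hom1 (W C) (pf_id ClIdlEx C);
     pn2 := fun C D G => eq2 (eps_nat G) |}.

Section DelNat.
Variables (C D : ClIdlEx) (G : hom1 C D).

(** Both short exact sequences of rows have the middle row [om_ob ch G S].
    The nullity of a morphism of rows is that of its middle component, where
    one is left with the replacement of [G X -> G Y -> G Z]. *)
Lemma del_nat_null (S : SesCl C) : null (cl_idl (SesCl D))
  (sg (del_ob ch (om_ob ch G S)) ∘ idm (om_ob ch G S)
    ∘ sf (om_ob ch (om1 ch G) (del_ob ch S))).
Proof.
rewrite cmp1m; apply/(ses_nullP (@cl_closed D)); apply: om_sg_null.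
by move/(ses_nullP (@cl_closed D)): (om_ker_null (om1 ch G) (del_ob ch S)).
Qed.

Lemma del_natV_null (S : SesCl C) : null (cl_idl (SesCl D))
  (sg (om_ob ch (om1 ch G) (del_ob ch S)) ∘ idm (om_ob ch G S)
    ∘ sf (del_ob ch (om_ob ch G S))).
Proof.
rewrite cmp1m; apply/(ses_nullP (@cl_closed D)); apply: om_sf_null.
by move/(ses_nullP (@cl_closed D)): (om_coker_null (om1 ch G) (del_ob ch S)).
Qed.

Lemma del_nat_nat (S S' : SesCl C) (m : Hom S S') :
  idm (om_ob ch G S') ∘ mv (fmap (pf1 W (pf1 W G) ⊚ delta1 ch C) m)
  = mv (fmap (delta1 ch D ⊚ pf1 W G) m) ∘ idm (om_ob ch G S).
Proof. by apply: ses_hom_ext; rewrite /= cmp1m cmpm1. Qed.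

Definition del_nat :
    hom2 (pf1 W (pf1 W G) ⊚ delta1 ch C) (delta1 ch D ⊚ pf1 W G) :=
  mid_cell (pf1 W (pf1 W G) ⊚ delta1 ch C) (delta1 ch D ⊚ pf1 W G)
    (fun _ => eq_refl) del_nat_nat del_nat_null.

Lemma over_del_nat (E0 : ClIdlEx) (E : hom1 (W D) E0) :
  Over (E ⊚ epsilon1 (W D)) del_nat.
Proof. exact: over_mid_cell. Qed.
End DelNat.

Definition del_pn : PnData W (pf_comp W W) :=
  {| pn1 := delta1 ch : forall C, hom1 (W C) (pf_comp W W C);
     pn2 := fun C D G => del_nat G |}.

(** * Cells of the comonad laws *)

Section ComonadCells.
Variable C : ClIdlEx.

(** The functor [delta] preserves middle components, so that the replacement
    of [delta (delta S)] under [Omega delta] is taken over the very morphisms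
    of [delta S]. *)
Lemma coassoc_null (S : SesCl C) : null (cl_idl (SesCl (SesCl C)))
  (sg (del_ob ch (del_ob ch S)) ∘ idm (del_ob ch S)
    ∘ sf (om_ob ch (delta1 ch C) (del_ob ch S))).
Proof.
have E : mv (sg (del_ob ch (del_ob ch S)))
    = mv (fmap (delta1 ch C) (sg (del_ob ch S))) by [].
have := om_ker_null (delta1 ch C) (del_ob ch S).
rewrite cmp1m => /(ses_nullP (@cl_closed (SesCl C))) n.
apply/(ses_nullP (@cl_closed (SesCl C))).
by rewrite ses_mvE E; rewrite ses_mvE in n.
Qed.

Lemma coassocV_null (S : SesCl C) : null (cl_idl (SesCl (SesCl C)))
  (sg (om_ob ch (delta1 ch C) (del_ob ch S)) ∘ idm (del_ob ch S)
    ∘ sf (del_ob ch (del_ob ch S))).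
Proof.
have E : mv (sf (del_ob ch (del_ob ch S)))
    = mv (fmap (delta1 ch C) (sf (del_ob ch S))) by [].
have := om_coker_null (delta1 ch C) (del_ob ch S).
rewrite cmp1m => /(ses_nullP (@cl_closed (SesCl C))) n.
apply/(ses_nullP (@cl_closed (SesCl C))).
by rewrite ses_mvE E; rewrite ses_mvE in n.
Qed.

Lemma coassoc_nat (S S' : SesCl C) (m : Hom S S') :
  idm (del_ob ch S') ∘ mv (fmap (pf1 W (delta1 ch C) ⊚ delta1 ch C) m)
  = mv (fmap (delta1 ch (W C) ⊚ delta1 ch C) m) ∘ idm (del_ob ch S).
Proof. by do 2 apply: ses_hom_ext; rewrite /= cmp1m cmpm1. Qed.

Definition coassoc :
    hom2 (pf1 W (delta1 ch C) ⊚ delta1 ch C) (delta1 ch (W C) ⊚ delta1 ch C) :=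
  mid_cell (pf1 W (delta1 ch C) ⊚ delta1 ch C) (delta1 ch (W C) ⊚ delta1 ch C)
    (fun _ => eq_refl) coassoc_nat coassoc_null.

Lemma counit_lE : epsilon1 (W C) ⊚ delta1 ch C = id1 (W C).
Proof. exact: exf_ext_strict. Qed.

Lemma counit_r_null (S : SesCl C) : null (cl_idl C)
  (sg S ∘ idm (sY S) ∘ sf (om_ob ch (epsilon1 C) (del_ob ch S))).
Proof. by rewrite cmp1m; apply: (om_ker_null (epsilon1 C) (del_ob ch S)). Qed.

Lemma counit_rV_null (S : SesCl C) : null (cl_idl C)
  (sg (om_ob ch (epsilon1 C) (del_ob ch S)) ∘ idm (sY S) ∘ sf S).
Proof.
by rewrite cmp1m; apply: (om_coker_null (epsilon1 C) (del_ob ch S)).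
Qed.

Lemma counit_r_nat (S S' : SesCl C) (m : Hom S S') :
  idm (sY S') ∘ mv (fmap (pf1 W (epsilon1 C) ⊚ delta1 ch C) m)
  = mv (fmap (id1 (W C)) m) ∘ idm (sY S).
Proof. by rewrite /= cmp1m cmpm1. Qed.

Definition counit_r : hom2 (pf1 W (epsilon1 C) ⊚ delta1 ch C) (id1 (W C)) :=
  mid_cell (pf1 W (epsilon1 C) ⊚ delta1 ch C) (id1 (W C))
    (fun _ => eq_refl) counit_r_nat counit_r_null.

Lemma over_coassoc (E0 : ClIdlEx) (E : hom1 (W (W C)) E0) :
  Over (E ⊚ epsilon1 (W (W C))) coassoc.
Proof. exact: over_mid_cell. Qed.

Lemma over_counit_r (E0 : ClIdlEx) (E : hom1 C E0) :
  Over (E ⊚ epsilon1 C) counit_r.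
Proof. exact: over_mid_cell. Qed.
End ComonadCells.

(** * Identities under the action of the pseudofunctor *)

Section OverOmega.
Variables (C D E0 : ClIdlEx) (E : hom1 D E0).

(** [epsilon ⊚ Omega G] computes to [G ⊚ epsilon]. *)
Lemma over_whiskl_om (B : ClIdlEx) (G : hom1 C D) (H K : hom1 B (W C))
  (a : hom2 H K) :
  Over ((E ⊚ G) ⊚ epsilon1 C) a -> Over (E ⊚ epsilon1 D) (pf1 W G ◁ a).
Proof. by []. Qed.

Lemma over_om2 (G H : hom1 C D) (a : hom2 G H) :
  Over E a -> Over (E ⊚ epsilon1 D) (pf2 W a).
Proof. by move=> o S; apply: o. Qed.

Lemma over_om_mul (B : ClIdlEx) (G : hom1 C D) (F : hom1 B C) :
  Over (E ⊚ epsilon1 D) (pf_mul W G F).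
Proof. by apply: over_mid => S; apply: idlike_idm. Qed.

Lemma over_om_mulV (B : ClIdlEx) (G : hom1 C D) (F : hom1 B C) :
  Over (E ⊚ epsilon1 D) (pf_mulV W G F).
Proof. by apply: over_mid => S; apply: idlike_idm. Qed.

Lemma over_om_unit (F : hom1 (W C) E0) : Over F (pf_unit W C).
Proof. exact: over_eq2. Qed.
End OverOmega.

(** [epsilon ⊚ delta] computes to the identity. *)
Lemma over_whiskl_del (B D E0 : ClIdlEx) (E : hom1 (W D) E0)
  (H K : hom1 B (W D)) (a : hom2 H K) :
  Over E a -> Over (E ⊚ epsilon1 (W D)) (delta1 ch D ◁ a).
Proof. by []. Qed.

Ltac faithful := repeat
  match goal with
  | |- Faithful (exf (_ ⊚ epsilon1 _)) => apply: eps_comp_faithful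
  | |- Faithful _ => apply: id_faithful
  end.

(** One rule for each way of building a 2-cell.  The rule is selected by the
    head symbol and applied to explicit arguments, so that no cell is ever
    unfolded to its components: comparing unfolded components would compare the
    proofs stored in composite functors. *)
Ltac over_step :=
  match goal with
  | |- Over ?E (?b • ?a) => refine (over_comp2 (E := E) (b := b) (a := a) _ _)
  | |- Over ?E (asc ?h ?g ?f) => exact (over_asc h g f E)
  | |- Over ?E (csa ?h ?g ?f) => exact (over_csa h g f E)
  | |- Over ?E (lun ?f) => exact (over_lun f E)
  | |- Over ?E (run ?f) => exact (over_run f E)
  | |- Over ?E (lunr ?f) => exact (over_lunr f E)
  | |- Over ?E (eq2 ?e) => exact (over_eq2 E e)
  | |- Over ?E (id2 ?f) => exact (over_eq2 E (eq_refl f))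
  | |- Over ?E (?a ▷ ?h) => refine (over_whiskr (E := E) (a := a) h _)
  (* [change] reduces composite and whiskered data to their constituents *)
  | |- Over ?E (pf_unit (pf_id _) ?A) => exact (over_eq2 E (eq_refl (id1 A)))
  | |- Over ?E (pf_mul (pf_id _) ?g ?f) => exact (over_eq2 E (eq_refl (g ⊚ f)))
  | |- Over ?E (pf_unit (pf_comp ?G ?F) ?A) =>
      change (Over E (pf2 G (pf_unit F A) • pf_unit G (F A)))
  | |- Over ?E (pf_mul (pf_comp ?G ?F) ?g ?f) =>
      change (Over E (pf2 G (pf_mul F g f) • pf_mul G (pf1 F g) (pf1 F f)))
  | |- Over ?E (pf1 (pf_base (pf_id _)) ?h ◁ ?a) =>
      refine (over_whiskl (E := E) (h := h) (a := a) _)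
  | |- Over ?E (pf1 (pf_compb ?G ?F) ?h ◁ ?a) =>
      change (Over E (pf1 G (pf1 F h) ◁ a))
  | |- Over ?E (pf1 (pf_base (pf_comp ?G ?F)) ?h ◁ ?a) =>
      change (Over E (pf1 G (pf1 F h) ◁ a))
  | |- Over ?E (pn1 (pn_whiskr ?s ?H) ?C ◁ ?a) =>
      change (Over E (pn1 s (H C) ◁ a))
  | |- Over ?E (pn1 (pn_whiskl ?H ?s) ?C ◁ ?a) =>
      change (Over E (pf1 H (pn1 s C) ◁ a))
  | |- Over ?E (pn1 eps_pn ?C ◁ ?a) => change (Over E (epsilon1 C ◁ a))
  | |- Over ?E (pn1 del_pn ?C ◁ ?a) => change (Over E (delta1 ch C ◁ a))
  | |- Over ?E (pn2 (pn_id ?F) ?f) => exact (over_runl (pf1 F f) E)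
  | |- Over ?E (pn2 (@pn_comp _ _ _ ?G ?H ?t ?s) (A:=?A) (B:=?B) ?f) =>
      change (Over E (asc (t B) (s B) _ • (t B ◁ pn2 s f)
        • csa (t B) (pf1 G f) (s A) • (pn2 t f ▷ s A)
        • asc (pf1 H f) (t A) (s A)))
  | |- Over ?E (pn2 (pn_whiskl ?H (G:=?G) ?s) (A:=?A) (B:=?B) ?f) =>
      change (Over E (pf_mulV H (s B) _ • pf2 H (pn2 s f)
        • pf_mul H (pf1 G f) (s A)))
  | |- Over ?E (pn2 (pn_whiskr ?s ?H) ?f) => change (Over E (pn2 s (pf1 H f)))
  | |- Over ?E (pn2 eps_pn ?G) => exact (over_eq2 E (eps_nat G))
  | |- Over (?E ⊚ epsilon1 _) (pn2 del_pn ?G) => exact (over_del_nat G E)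
  | |- Over (?E ⊚ epsilon1 _) (del_nat ?G) => exact (over_del_nat G E)
  | |- Over (?E ⊚ epsilon1 _) (counit_r ?C) => exact (over_counit_r E)
  | |- Over (?E ⊚ epsilon1 _) (coassoc ?C) => exact (over_coassoc E)
  | |- Over ?E (pf_unit _ ?C) => exact (over_om_unit E)
  | |- Over (?E ⊚ epsilon1 _) (pf_mul _ ?G ?F) => exact (over_om_mul E G F)
  | |- Over (?E ⊚ epsilon1 _) (pf_mulV _ ?G ?F) => exact (over_om_mulV E G F)
  | |- Over (?E ⊚ epsilon1 _) (pf2 _ ?a) =>
      refine (over_om2 (E := E) (a := a) _)
  | |- Over (?E ⊚ epsilon1 _) (pf1 _ ?G ◁ ?a) =>
      refine (over_whiskl_om (E := E) (G := G) (a := a) _)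
  | |- Over (?E ⊚ epsilon1 _) (delta1 _ _ ◁ ?a) =>
      refine (over_whiskl_del (E := E) (a := a) _)
  | |- Over ?E (epsilon1 ?C ◁ ?a) =>
      refine (over_whiskl (E := E) (h := epsilon1 C) (a := a) _)
  end.

Ltac over := repeat over_step.

Ltac over_eq E := apply: (over_uniq (E := E)); [faithful | over | over].

(** * The pseudo-comonad *)

Lemma Omega_pf : IsPseudofunctor W.
Proof.
split.
- by move=> *; apply: nt_mid_ext.
- by move=> *; apply: nt_mid_ext.
- by move=> A; apply: eq2_iso.
- move=> A B C g f; over_eq (id1 C ⊚ epsilon1 C).
- move=> A B C g f; over_eq (id1 C ⊚ epsilon1 C).
- by move=> *; apply: nt_mid_ext => S /=; rewrite cmp1m cmpm1.
- by move=> *; apply: nt_mid_ext => S /=; rewrite cmp1m cmpm1.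
- move=> A B C D h g f; over_eq (id1 D ⊚ epsilon1 D).
- move=> A B f; over_eq (id1 B ⊚ epsilon1 B).
- move=> A B f; over_eq (id1 B ⊚ epsilon1 B).
Qed.

Lemma eps_pseudonatural :
  @IsPseudonatural ClIdlEx ClIdlEx W (pf_id ClIdlEx) eps_pn.
Proof.
split.
- by move=> *; apply: eq2_iso.
- move=> C D F G a; apply: nt_ext => S; rewrite /comp2 /= !eq2_nt !eqhom_id.
  by rewrite cmp1m cmpm1.
- move=> C; over_eq (id1 C).
- move=> B C D G F; over_eq (id1 D).
Qed.

Lemma eps_two_natural : TwoNatural eps_pn.
Proof. by move=> C D G; exists (eps_nat G). Qed.

Lemma del_pseudonatural :
  @IsPseudonatural ClIdlEx ClIdlEx W (pf_comp W W) del_pn.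
Proof.
split.
- by move=> C D G; apply: mid_cell_iso; apply: del_natV_null.
- move=> C D G H a; apply: nt_mid_ext => S; apply: ses_hom_ext.
  by rewrite /= cmp1m cmpm1.
- move=> C; over_eq ((id1 _ ⊚ epsilon1 C) ⊚ epsilon1 _).
- move=> B C D G F; over_eq ((id1 _ ⊚ epsilon1 D) ⊚ epsilon1 _).
Qed.

Definition coassoc_modif : @InvModif ClIdlEx ClIdlEx W
  (pf_compb W (pf_compb W W))
  (pn_comp (pn_whiskl W del_pn) del_pn) (pn_comp (pn_whiskr del_pn W) del_pn).
Proof.
refine (@Build_InvModif ClIdlEx ClIdlEx W (pf_compb W (pf_compb W W))
  (pn_comp (pn_whiskl W del_pn) del_pn) (pn_comp (pn_whiskr del_pn W) del_pn)
  coassoc _ _).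
- by move=> C; apply: mid_cell_iso; apply: coassocV_null.
- move=> C D G; over_eq ((id1 _ ⊚ epsilon1 (W D)) ⊚ epsilon1 _).
Defined.

Definition counit_l_modif : @InvModif ClIdlEx ClIdlEx W W
  (pn_comp (pn_whiskr eps_pn W) del_pn) (pn_id W).
Proof.
refine (@Build_InvModif ClIdlEx ClIdlEx W W
  (pn_comp (pn_whiskr eps_pn W) del_pn) (pn_id W)
  (fun C => eq2 (counit_lE C)) _ _).
- by move=> C; apply: eq2_iso.
- move=> C D G; over_eq (id1 _ ⊚ epsilon1 D).
Defined.

Definition counit_r_modif : @InvModif ClIdlEx ClIdlEx W W
  (pn_comp (pn_whiskl W eps_pn) del_pn) (pn_id W).
Proof.
refine (@Build_InvModif ClIdlEx ClIdlEx W W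
  (pn_comp (pn_whiskl W eps_pn) del_pn) (pn_id W) counit_r _ _).
- by move=> C; apply: mid_cell_iso; apply: counit_rV_null.
- move=> C D G; over_eq (id1 _ ⊚ epsilon1 D).
Defined.

(** Two counits suffice although the cells land in a fourfold iterate of [Omega]:
    coassociativity is an identity after one of them, and [pf2 W] raises the
    number by one. *)
Lemma coassoc_pentagon (C : ClIdlEx) :
  let d := delta1 ch C in let dW := delta1 ch (W C) in
  let dWW := delta1 ch (W (W C)) in
  (coassoc (W C) ▷ d)
  • asc (pf1 W dW) dW d
  • (pf1 W dW ◁ coassoc C)
  • csa (pf1 W dW) (pf1 W d) d
  • (pf_mulV W dW d ▷ d)
  • (pf2 W (coassoc C) ▷ d)
  • (pf_mul W (pf1 W d) d ▷ d)
  • asc (pf1 W (pf1 W d)) (pf1 W d) d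
  = asc dWW dW d
  • (dWW ◁ coassoc C)
  • csa dWW (pf1 W d) d
  • (del_nat d ▷ d)
  • asc (pf1 W (pf1 W d)) dW d
  • (pf1 W (pf1 W d) ◁ coassoc C).
Proof.
cbv zeta; over_eq ((id1 _ ⊚ epsilon1 (W (W C))) ⊚ epsilon1 (W (W (W C)))).
Qed.

Lemma coassoc_triangle (C : ClIdlEx) :
  let d := delta1 ch C in let dW := delta1 ch (W C) in
  let eW := epsilon1 (W C) in
  (pf_unit W (W C) ▷ d)
  • (counit_r (W C) ▷ d)
  • asc (pf1 W eW) dW d
  • (pf1 W eW ◁ coassoc C)
  = (pf2 W (eq2 (counit_lE C)) ▷ d)
  • (pf_mul W eW d ▷ d)
  • asc (pf1 W eW) (pf1 W d) d.
Proof. cbv zeta; over_eq ((id1 _ ⊚ epsilon1 C) ⊚ epsilon1 (W C)). Qed.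

Definition omega_comonad : PseudoComonad W :=
  {| pc_pf := Omega_pf;
     pc_eps := eps_pn; pc_eps_pn := eps_pseudonatural;
     pc_del := del_pn; pc_del_pn := del_pseudonatural;
     pc_assoc := coassoc_modif;
     pc_lunit := counit_l_modif;
     pc_runit := counit_r_modif;
     pc_pentagon := coassoc_pentagon;
     pc_triangle := coassoc_triangle |}.

(** * Pretorsion theories as pseudo-coalgebras *)

Section Coalgebra.
Variables (C0 : Cat) (T F : C0 -> Prop) (pt : IsPretorsionTheory T F).
Variables (hk : HasKernels (TFIdeal T F)) (hc : HasCokernels (TFIdeal T F)).
Variable ts : forall X : C0, TorsionSeq T F X.
Let C : ClIdlEx := TFClIdl hk hc.
Let lam : hom1 C (W C) := lambda1 pt hk hc ts.

Lemma lam_counit : epsilon1 C ⊚ lam = id1 C.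
Proof. exact: exf_ext_strict. Qed.

(** As [lam] preserves middle components, both nullity conditions are those
    of the torsion sequence of [X] itself. *)
Lemma lam_del_null (X : C) : null (cl_idl (SesCl C))
  (sg (del_ob ch (lam X)) ∘ idm (lam X) ∘ sf (om_ob ch lam (lam X))).
Proof.
have := om_ker_null lam (lam X).
rewrite cmp1m => /(ses_nullP (@cl_closed C)) n.
by apply/(ses_nullP (@cl_closed C)).
Qed.

Lemma lam_delV_null (X : C) : null (cl_idl (SesCl C))
  (sg (om_ob ch lam (lam X)) ∘ idm (lam X) ∘ sf (del_ob ch (lam X))).
Proof.
have := om_coker_null lam (lam X).
rewrite cmp1m => /(ses_nullP (@cl_closed C)) n.
by apply/(ses_nullP (@cl_closed C)).
Qed.

Lemma lam_del_nat (X Y : C) (h : Hom X Y) :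
  idm (lam Y) ∘ mv (fmap (pf1 W lam ⊚ lam) h)
  = mv (fmap (delta1 ch C ⊚ lam) h) ∘ idm (lam X).
Proof. by apply: ses_hom_ext; rewrite /= cmp1m cmpm1. Qed.

Definition lam_del : hom2 (pf1 W lam ⊚ lam) (delta1 ch C ⊚ lam) :=
  mid_cell (pf1 W lam ⊚ lam) (delta1 ch C ⊚ lam) (fun _ => eq_refl)
    lam_del_nat lam_del_null.

Lemma lam_del_iso : IsIso2 lam_del.
Proof. by apply: mid_cell_iso; apply: lam_delV_null. Qed.

Lemma over_lam_del (E0 : ClIdlEx) (E : hom1 (W C) E0) :
  Over (E ⊚ epsilon1 (W C)) lam_del.
Proof. exact: over_mid_cell. Qed.

Ltac over_lam := repeat first
  [ over_step
  | match goal with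
    | |- Over (?E ⊚ epsilon1 _) lam_del => exact (over_lam_del E)
    end ].

Lemma lam_pentagon :
  let l := lam in let d := delta1 ch C in let dW := delta1 ch (W C) in
  (coassoc C ▷ l)
  • asc (pf1 W d) d l
  • (pf1 W d ◁ lam_del)
  • csa (pf1 W d) (pf1 W l) l
  • (pf_mulV W d l ▷ l)
  • (pf2 W lam_del ▷ l)
  • (pf_mul W (pf1 W l) l ▷ l)
  • asc (pf1 W (pf1 W l)) (pf1 W l) l
  = asc dW d l
  • (dW ◁ lam_del)
  • csa dW (pf1 W l) l
  • (del_nat l ▷ l)
  • asc (pf1 W (pf1 W l)) d l
  • (pf1 W (pf1 W l) ◁ lam_del).
Proof.
cbv zeta.
apply: (over_uniq (E := (id1 _ ⊚ epsilon1 (W C)) ⊚ epsilon1 (W (W C))));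
  [faithful | over_lam | over_lam].
Qed.

Lemma lam_triangle :
  let l := lam in let d := delta1 ch C in let e := epsilon1 C in
  (pf_unit W C ▷ l)
  • (counit_r C ▷ l)
  • asc (pf1 W e) d l
  • (pf1 W e ◁ lam_del)
  = (pf2 W (eq2 lam_counit) ▷ l)
  • (pf_mul W e l ▷ l)
  • asc (pf1 W e) (pf1 W l) l.
Proof.
cbv zeta.
apply: (over_uniq (E := id1 _ ⊚ epsilon1 C)); [faithful | over_lam | over_lam].
Qed.

Definition pretorsion_coalgebra : NormalPseudoCoalgebra omega_comonad C :=
  @Build_NormalPseudoCoalgebra ClIdlEx W omega_comonad C lam lam_counit lam_del
    lam_del_iso lam_pentagon lam_triangle.
End Coalgebra.
End Omega.

Theorem theorem4p6 (ch : Choice) :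
  exists P : PseudoComonad (Omega ch),
    (forall C : ClIdlEx, pc_eps P C = epsilon1 C) /\
    (forall C : ClIdlEx, pc_del P C = delta1 ch C) /\
    TwoNatural (pc_eps P) /\
    (forall (C : Cat) (T F : C -> Prop) (pt : IsPretorsionTheory T F)
       (hk : HasKernels (TFIdeal T F)) (hc : HasCokernels (TFIdeal T F))
       (ts : forall X : C, TorsionSeq T F X),
       exists A : NormalPseudoCoalgebra P (TFClIdl hk hc : ClIdlEx),
         ca_map A = lambda1 pt hk hc ts).
Proof.
exists (omega_comonad ch); split; [by []|split; [by []|split]].
- exact: eps_two_natural.
- by move=> C T F pt hk hc ts; exists (pretorsion_coalgebra ch pt hk hc ts).
Qed.
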